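(* Let $\mathbb{K}$ be an algebraic number field. Let $c\in\mathbb{K}^{\mathbb{N}}$ be $C$-finite of order $r$, let $\lambda_1,\dots,\lambda_m$ be its eigenvalues, and assume $\lambda_i\ne0$ for all $i=1,\dots,m$. Let $d$ be the torsion number of $\lambda_1,\dots,\lambda_m$. Then for all $j,k,\ell\in\mathbb{N}$ the sequence $(c(jn^2+kn+\ell))_{n\in\mathbb{N}}$ satisfies a $C^2$-finite recurrence over $\mathbb{K}$ of order at most $dr$, and such a recurrence can be computed.
   Context: $\mathbb{N}=\{0,1,2,\dots\}$. A sequence $c\in\mathbb{K}^{\mathbb{N}}$ is called $C$-finite over $\mathbb{K}$ if it satisfies a linear recurrence $\gamma_0c(n)+\dots+\gamma_tc(n+t)=0$ for all $n\in\mathbb{N}$ with constants $\gamma_i\in\mathbb{K}$, $\gamma_t\ne0$; its order is the minimal such $t$. The characteristic polynomial of $c$ is the polynomial $\sum_{i=0}^{t-1}\gamma_ix^i+x^t\in\mathbb{K}[x]$ corresponding to the unique monic recurrence of minimal order $t$. The eigenvalues of $c$ in this statement are the pairwise distinct roots of its characteristic polynomial in a splitting field, so the assumption $\lambda_i\neq0$ says that $0$ is not a root of the characteristic polynomial. A $C^2$-finite recurrence over $\mathbb{K}$ of order $s$ for a sequence $a\in\mathbb{K}^{\mathbb{N}}$ is a relation $c_0(n)a(n)+\dots+c_s(n)a(n+s)=0$ valid for all $n\in\mathbb{N}$, where $c_0,\dots,c_s$ are $C$-finite sequences over $\mathbb{K}$ and there is $n_1\in\mathbb{N}$ with $c_s(n)\neq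 0$ for all $n\ge n_1$. For nonzero algebraic numbers $\lambda_1,\dots,\lambda_m$, let $G=\langle\lambda_1,\dots,\lambda_m\rangle\le(\mathbb{C}^\times,\cdot)$ be the multiplicative group they generate and $T(G)$ its torsion subgroup (the elements of finite order). The torsion number of $\lambda_1,\dots,\lambda_m$ is $d=\exp(T(G))=\operatorname{lcm}(\operatorname{ord}(\lambda)\mid\lambda\in T(G))$. *)

(* Defs.v *)
From HB Require Import structures.
From mathcomp Require Import all_boot all_order all_algebra all_field.

Set Implicit Arguments.
Unset Strict Implicit.
Unset Printing Implicit Defensive.

Import Order.TTheory GRing.Theory Num.Theory.

Local Open Scope ring_scope.

Section Sequences.

Variable K : fieldType.
Implicit Types (c a : nat -> K) (t r s : nat).

Definition C_recurrence t (gamma : nat -> K) c : Prop :=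
  gamma t != 0 /\ forall n : nat, \sum_(i < t.+1) gamma i * c (n + i)%N = 0.

Definition C_finite c : Prop := exists t gamma, C_recurrence t gamma c.

Definition C_finite_of_order c r : Prop :=
  (exists gamma, C_recurrence r gamma c) /\
  (forall t gamma, C_recurrence t gamma c -> (r <= t)%N).

Definition characteristic_poly c (chi : {poly K}) : Prop :=
  [/\ C_finite_of_order c (size chi).-1, chi \is monic &
      C_recurrence (size chi).-1 (fun i => chi`_i) c].

(* The coefficient sequences are cs 0, ..., cs s; cs i is irrelevant for
   i > s. *)
Definition C2_finite_recurrence s (cs : nat -> nat -> K) a : Prop :=
  [/\ forall i, (i <= s)%N -> C_finite (cs i),
      exists n1 : nat, forall n, (n1 <= n)%N -> cs s n != 0 &
      forall n : nat, \sum_(i < s.+1) cs i n * a (n + i)%N = 0].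

(* A C-finite sequence as finite data: the coefficients of some recurrence it
   satisfies, not necessarily of minimal order t, and its first t terms. *)
Definition presents (D : seq K * seq K) c : Prop :=
  [/\ size D.1 = (size D.2).+1,
      C_recurrence (size D.2) (fun i => D.1`_i) c &
      D.2 = mkseq c (size D.2)].

End Sequences.

Section Torsion.

Variable F : fieldType.
Implicit Types (lam : seq F) (z : F).

Definition in_mul_group lam z : Prop :=
  exists e : nat -> int, z = \prod_(i < size lam) lam`_i ^ e i.

Definition in_torsion lam z : Prop :=
  in_mul_group lam z /\ exists2 n : nat, (0 < n)%N & z ^+ n = 1.

(* d is the least common multiple of the orders of the torsion elements;
   z has order n iff n.-primitive_root z. *)
Definition is_torsion_number lam (d : nat) : Prop :=
  (forall z n, in_torsion lam z -> n.-primitive_root z -> n %| d)%N /\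
  (forall e, (forall z n, in_torsion lam z -> n.-primitive_root z -> n %| e) ->
     d %| e)%N.

End Torsion.

(* Kleene's partial recursive functions of several variables. *)
Inductive recfun : Type :=
  | Zero
  | Succ
  | Proj of nat
  | Comp of recfun & seq recfun
  | PrimRec of recfun & recfun
  | Mu of recfun.

(* [recfun_eval f v y]: f is defined at the arguments v, with value y. *)
Inductive recfun_eval : recfun -> seq nat -> nat -> Prop :=
  | eval_zero v : recfun_eval Zero v 0
  | eval_succ x v : recfun_eval Succ (x :: v) x.+1
  | eval_proj i v : (i < size v)%N -> recfun_eval (Proj i) v (nth 0%N v i)
  | eval_comp f gs v ys y :
      recfun_evals gs v ys -> recfun_eval f ys y ->
      recfun_eval (Comp f gs) v y
  | eval_primrec0 f g v y :
      recfun_eval f v y -> recfun_eval (PrimRec f g) (0%N :: v) y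
  | eval_primrecS f g n v z y :
      recfun_eval (PrimRec f g) (n :: v) z ->
      recfun_eval g (n :: z :: v) y ->
      recfun_eval (PrimRec f g) (n.+1 :: v) y
  | eval_mu f v y (z : nat -> nat) :
      (forall i, (i < y)%N -> recfun_eval f (i :: v) (z i).+1) ->
      recfun_eval f (y :: v) 0 ->
      recfun_eval (Mu f) v y
with recfun_evals : seq recfun -> seq nat -> seq nat -> Prop :=
  | evals_nil v : recfun_evals [::] v [::]
  | evals_cons g gs v y ys :
      recfun_eval g v y -> recfun_evals gs v ys ->
      recfun_evals (g :: gs) v (y :: ys).

(* Number field elements are given to algorithms by their rational coordinates
   on a fixed basis (the choice of basis is immaterial for computability), and
   rationals by sign, numerator and denominator.  Nested lists of naturals are
   coded by [pickle], i.e. by iterating the effective pairing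
   (a, b) |-> 2 ^ a * (2 * b + 1). *)
Definition rat_digits (q : rat) : seq nat :=
  [:: nat_of_bool (q < 0); `|numq q|%N; `|denq q|%N].

Section Encoding.

Variable K : fieldExtType rat.

Definition elt_digits (x : K) : seq (seq nat) :=
  [seq rat_digits (coord (vbasis {:K}) i x) | i <- enum 'I_(\dim {:K})].

Definition data_digits (D : seq K * seq K) : seq (seq (seq (seq nat))) :=
  [:: map elt_digits D.1; map elt_digits D.2].

Definition code_data (D : seq K * seq K) : nat := pickle (data_digits D).

Definition code_data_list (E : seq (seq K * seq K)) : nat :=
  pickle (map data_digits E).

End Encoding.

(* Main.v *)
Require Import Defs.
From Stdlib Require Import Classical FunctionalExtensionality.
From HB Require Import structures.
From mathcomp Require Import all_boot all_order all_algebra all_field.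
From mathcomp Require Import fingroup perm zify ring.

Set Implicit Arguments.
Unset Strict Implicit.
Unset Printing Implicit Defensive.

Import Order.TTheory GRing.Theory Num.Theory.

Local Open Scope ring_scope.

(** The idea.  Put x = j n^2 + k n + l and N_i(n) = 2 j e i n + j e^2 i^2 + k e i,
    so that a(n + e i) = c(x + N_i(n)).  All shifts of c lie in a space of
    dimension r, and within that space the sequence y |-> c(y + N_i(n)) depends
    on i and n through values of c at arguments that are affine in n.  Hence the
    r + 1 sequences obtained for i = 0, ..., r are linearly dependent, with
    coefficients that are minors of the matrix of the window values
    c(N_i(n) + b).  These minors are C-finite in n, and a dependence between the
    windows is a recurrence for a with step e ([recurrence_of_relation]).  Taking
    q as large as possible with a q-rowed minor that is not identically zero
    makes every bordering minor vanish ([exists_maximal_minor]), so that the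
    recurrence has q + 1 terms, q <= r, and that minor leads it.

    What has to be shown is that the leading minor vanishes only finitely often.
    Its image in the complex numbers is an exponential polynomial whose bases
    are e-th powers of products of eigenvalues.  For e = d these powers form a
    torsion-free group, where an exponential polynomial that vanishes along an
    arithmetic progression vanishes identically
    ([exp_poly_nondegenerate]); by the Skolem-Mahler-Lech theorem it then has
    finitely many zeros.  The order of the recurrence is d q <= d r.  The
    Skolem-Mahler-Lech theorem is proved by Hansel's elementary argument: modulo
    a suitable prime p, a power of the shift is the identity, which turns the
    sequence along a progression into a series sum_i C(n, i) p^i d_i with
    integers d_i, and such a series with infinitely many zeros is zero
    ([newton_series_inf_zero]).

    For the computation neither d nor the eigenvalues are needed.  Every torsion
    order divides M = (2 [K : Q] t^t)!, where t is the order of the presented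
    recurrence, since a root of unity whose degree over Q is at most D has an
    order dividing (2 D)! ([torsion_order_dvd_fact]).  So the leading minor is
    eventually non-zero as soon as it does not vanish identically on any
    residue class modulo M, and this can be decided from finitely many terms,
    because all sequences involved lie in shift-invariant spaces of dimension at
    most t^(q+1) or t^q ([prod_span_eq0]).  The algorithm searches for a
    certificate: the least positive step e that passes this test for some q
    and some choice of columns, together with presentations of the
    coefficients.  The step d passes ([torsion_number_good]), so that the step
    found is at most d although d is never computed.

    Computability is established by closing the class of functions realised by
    a [recfun] on codes under the operations that occur in the test; the test is
    then an ordinary boolean expression, and one unbounded search runs it. *)

(** * Polynomials acting on sequences by shifts *)

Section ShiftOperators.

Variable R : comNzRingType.
Implicit Types (P Q : {poly R}) (u v : nat -> R).

(** ['X] acts as the shift u |-> (n |-> u n.+1). *)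
Definition shift_op P u (n : nat) : R := \sum_(i < size P) P`_i * u (n + i)%N.

Lemma shift_op_wide m P u n :
  (size P <= m)%N -> shift_op P u n = \sum_(i < m) P`_i * u (n + i)%N.
Proof.
move=> leP; rewrite /shift_op.
rewrite (big_ord_widen _ (fun i => P`_i * u (n + i)%N) leP) big_mkcond /=.
apply: eq_bigr => i _; case: ltnP => // /(nth_default 0) ->; by rewrite mul0r.
Qed.

Arguments shift_op_wide [m P] u n _.

Lemma eq_shift_op P u v : u =1 v -> shift_op P u =1 shift_op P v.
Proof. by move=> uv n; apply: eq_bigr => i _; rewrite uv. Qed.

Lemma shift_opC a u n : shift_op a%:P u n = a * u n.
Proof.
by rewrite (shift_op_wide (m := 1)) ?size_polyC_leq1 // big_ord1 coefC /= addn0.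
Qed.

Lemma shift_op1 u n : shift_op 1 u n = u n.
Proof. by rewrite -polyC1 shift_opC mul1r. Qed.

Lemma shift_op0p u n : shift_op 0 u n = 0.
Proof. by rewrite /shift_op size_poly0 big_ord0. Qed.

Lemma shift_opMX P u n : shift_op (P * 'X) u n = shift_op P (fun m => u m.+1) n.
Proof.
have leM : (size (P * 'X)%R <= (size P).+1)%N.
  by apply: leq_trans (size_polyMleq P _) _; rewrite size_polyX addn2.
rewrite (shift_op_wide _ _ leM) big_ord_recl coefMX /= mul0r add0r.
by apply: eq_bigr => i _; rewrite coefMX /= addnS.
Qed.

Lemma shift_opD P Q u n : shift_op (P + Q) u n = shift_op P u n + shift_op Q u n.
Proof.
set m := maxn (size P) (size Q).
rewrite (shift_op_wide (m := m) _ _ (size_polyD _ _)).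
rewrite (shift_op_wide (m := m) u n (leq_maxl _ _)).
rewrite (shift_op_wide (m := m) u n (leq_maxr _ _)) -big_split /=.
by apply: eq_bigr => i _; rewrite coefD mulrDl.
Qed.

Lemma shift_opZ a P u n : shift_op (a *: P) u n = a * shift_op P u n.
Proof.
rewrite (shift_op_wide (m := size P)) ?size_scale_leq // mulr_sumr.
by apply: eq_bigr => i _; rewrite coefZ mulrA.
Qed.

Lemma shift_op_sum (I : Type) (s : seq I) (Ps : I -> {poly R}) u n :
  shift_op (\sum_(i <- s) Ps i) u n = \sum_(i <- s) shift_op (Ps i) u n.
Proof.
apply: (big_morph (fun P => shift_op P u n)) => [P Q|]; first exact: shift_opD.
exact: shift_op0p.
Qed.

Lemma shift_op_shift P u n :
  shift_op P (fun m => u m.+1) n = shift_op P u n.+1.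
Proof. by apply: eq_bigr => i _; rewrite addSn. Qed.

(** Multiplicativity makes divisibility of polynomials a tool for recurrences. *)
Lemma shift_opM P Q u n : shift_op (P * Q) u n = shift_op P (shift_op Q u) n.
Proof.
elim/poly_ind: P u n => [|P c IH] u n; first by rewrite mul0r !shift_op0p.
rewrite mulrDl !shift_opD mul_polyC shift_opZ shift_opC; congr (_ + _).
rewrite mulrAC !shift_opMX IH.
by apply: eq_shift_op => m; rewrite shift_op_shift.
Qed.

Lemma shift_opXn m u n : shift_op 'X^m u n = u (n + m)%N.
Proof.
elim: m u n => [|m IH] u n; first by rewrite expr0 shift_op1 addn0.
by rewrite exprSr shift_opMX IH addnS.
Qed.

Lemma shift_op_seqD P u v n :
  shift_op P (fun m => u m + v m) n = shift_op P u n + shift_op P v n.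
Proof. by rewrite -big_split; apply: eq_bigr => i _; rewrite mulrDr. Qed.

Lemma shift_op_seqZ P a u n :
  shift_op P (fun m => a * u m) n = a * shift_op P u n.
Proof. by rewrite mulr_sumr; apply: eq_bigr => i _; rewrite mulrCA. Qed.

Lemma shift_op_seq0 P u n : (forall m, u m = 0) -> shift_op P u n = 0.
Proof. by move=> u0; rewrite /shift_op big1 // => i _; rewrite u0 mulr0. Qed.

Lemma dvd_shift_op P Q u :
  (forall n, shift_op P u n = 0) -> forall n, shift_op (Q * P) u n = 0.
Proof. by move=> Pu n; rewrite shift_opM shift_op_seq0. Qed.

End ShiftOperators.

(** * Zeros of Newton series with p-adically small coefficients *)

Section Hansel.

Implicit Types (P Q : {poly int}).

(** Horner's rule [Q`_i = P`_i.+1 + t * Q`_i.+1] carries the divisibility of the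
    coefficients of P above degree h to those of Q from degree h on. *)
Lemma deflate P (t : int) : root P t ->
  exists2 Q, P = Q * ('X - t%:P) &
    forall (z : int) h, (forall i, (h < i)%N -> (z %| P`_i)%Z) ->
      forall i, (h <= i)%N -> (z %| Q`_i)%Z.
Proof.
move=> /factor_theorem [Q defP]; exists Q => // z h zP.
have defQ i : Q`_i = P`_i.+1 + t * Q`_i.+1.
  rewrite defP mulrBr coefB coefMX coefMC /=; ring.
suff zQ m i : (size Q <= i + m)%N -> (h <= i)%N -> (z %| Q`_i)%Z.
  by move=> i; apply: (zQ (size Q)); rewrite leq_addl.
elim: m i => [|m IH] i le_i le_h.
  by rewrite nth_default ?dvdz0 // -(addn0 i).
by rewrite defQ rpredD ?zP ?dvdz_mull // IH ?addSnnS // leqW.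
Qed.

Lemma deflate_seq P (ts : seq int) : uniq ts -> all (root P) ts ->
  exists2 Q, P = Q * \prod_(t <- ts) ('X - t%:P) &
    forall (z : int), (forall i, (size ts <= i)%N -> (z %| P`_i)%Z) ->
      forall i, (z %| Q`_i)%Z.
Proof.
elim: ts P => [|t ts IH] P /=.
  by exists P => [|z zP i]; rewrite ?big_nil ?mulr1 //; apply: zP.
case/andP=> t_ts uniq_ts /andP[Pt Pts].
have [Q defP zQ] := deflate Pt.
have Qts : all (root Q) ts.
  apply/allP=> x x_ts; have := allP Pts x x_ts.
  rewrite defP rootM root_XsubC => /orP[//|/eqP eq_x].
  by rewrite -eq_x x_ts in t_ts.
have [S defQ zS] := IH Q uniq_ts Qts.
exists S => [|z zP]; first by rewrite defP defQ big_cons [X in _ = S * X]mulrC mulrA.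
by apply: zS; apply: zQ.
Qed.

Definition ffact_poly m : {poly int} := \prod_(a < m) ('X - a%:R%:P).

Lemma size_ffact_poly m : size (ffact_poly m) = m.+1.
Proof. by rewrite /ffact_poly size_prod_XsubC /index_enum -enumT size_enum_ord. Qed.

Lemma ffact_polyE m (k : nat) : (ffact_poly m).[k%:R] = (k ^_ m)%:R.
Proof.
elim: m => [|m IH]; first by rewrite /ffact_poly big_ord0 hornerC.
rewrite /ffact_poly big_ord_recr hornerM -/(ffact_poly m) IH /= hornerXsubC.
rewrite ffactnSr natrM; case: (leqP m k) => [le_mk | lt_km].
  by rewrite natrB.
by rewrite ffact_small // !mul0r.
Qed.

(** Legendre's formula.  For p = 2 the valuation of [i`!] can be i - 1, and the
    coefficients of Newton series would not tend to zero. *)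
Lemma logn_fact_half p i : prime p -> (2 < p)%N -> (logn p i`! <= i./2)%N.
Proof.
move=> p_pr p_gt2; rewrite logn_fact //.
suff E n : (\sum_(1 <= k < n.+1) i %/ p ^ k <= (i - i %/ p ^ n) %/ 2)%N.
  apply: leq_trans (E _) _; rewrite divn2; apply: half_leq; exact: leq_subr.
elim: n => [|n IH]; first by rewrite big_geq.
rewrite big_nat_recr //=; apply: leq_trans (leq_add IH (leqnn _)) _.
rewrite expnSr divnMA; set a := (i %/ p ^ n)%N; set b := (a %/ p)%N.
have le_ai : (a <= i)%N by apply: leq_div.
have le_b : (3 * b <= a)%N.
  by rewrite mulnC; apply: leq_trans (leq_trunc_div a p); rewrite leq_mul2l p_gt2 orbT.
lia.
Qed.

Variables (p : nat) (d : nat -> int).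
Hypotheses (p_pr : prime p) (p_gt2 : (2 < p)%N).

(** In a series sum_i d_i p^i C(k, i) the i-th coefficient p^i / i! of the
    falling factorial tends to zero p-adically. *)
Definition newton_series k : int :=
  \sum_(i < k.+1) ('C(k, i)%:R * p%:R ^+ i * d i).

(** [N`!] times the partial sum of the series, as a polynomial in k; the factor
    keeps the coefficients [p ^ i / i`!] in the integers. *)
Definition newton_poly N : {poly int} :=
  \sum_(i < N.+1) (d i * p%:R ^+ i * (N ^_ (N - i))%:R) *: ffact_poly i.

Lemma newton_polyE N k : (k <= N)%N ->
  (newton_poly N).[k%:R] = N`!%:R * newton_series k.
Proof.
move=> le_kN; rewrite /newton_poly horner_sum /newton_series mulr_sumr.
pose term i := N`!%:R * ('C(k, i)%:R * p%:R ^+ i * d i).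
rewrite (big_ord_widen N.+1 term) ?ltnS // {}/term.
rewrite [RHS]big_mkcond /=; apply: eq_bigr => i _.
rewrite hornerZ ffact_polyE; case: ltnP => [_ | lt_ki]; last first.
  by rewrite (@ffact_small k i) // mulr0.
have -> : N`! = (N ^_ (N - i) * i`!)%N.
  have le_iN : (i <= N)%N by rewrite -ltnS.
  by rewrite -{2}(subKn le_iN) ffact_fact // leq_subr.
rewrite -(bin_ffact k i) !natrM; ring.
Qed.

(** Coefficients from degree h on only receive terms with i >= h, and those are
    divisible by p^(h/2) beyond the scaling factor [N`!]. *)
Lemma newton_poly_coef N h j : (h <= j)%N ->
  ((p ^ (logn p N`! + h./2))%:Z %| (newton_poly N)`_j)%Z.
Proof.
move=> le_hj; rewrite /newton_poly coef_sum.
apply: (big_ind (fun x => (_ %| x)%Z)) => [|x y|i _]; first exact: dvdz0.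
  exact: rpredD.
rewrite coefZ; case: (ltnP i j) => [lt_ij | le_ji].
  by rewrite (nth_default 0 (s := ffact_poly i)) ?mulr0 ?dvdz0 // size_ffact_poly.
rewrite dvdz_mulr // -mulrA dvdz_mull // -natrX -natrM.
rewrite natz dvdzE !absz_nat.
have le_iN : (i <= N)%N by rewrite -ltnS.
have ff_gt0 : (0 < N ^_ (N - i))%N by rewrite ffact_gt0 leq_subr.
have pi_gt0 : (0 < p ^ i)%N by rewrite expn_gt0 prime_gt0.
have -> : N`! = (N ^_ (N - i) * i`!)%N.
  by rewrite -{2}(subKn le_iN) ffact_fact // leq_subr.
rewrite pfactor_dvdn ?muln_gt0 ?pi_gt0 ?ff_gt0 //.
rewrite lognM ?fact_gt0 // lognM // pfactorK //.
have := logn_fact_half i p_pr p_gt2.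
have := half_leq (leq_trans le_hj le_ji).
have := odd_double_half i. lia.
Qed.

(** Hansel's argument.  Dividing [newton_poly] by 2h of the zeros of the series
    leaves a polynomial with all coefficients divisible by p^h, up to the factor
    [N`!].  Hence every value of the series is divisible by p^h, for all h. *)
Lemma newton_series_inf_zero :
  (forall B, exists2 k, (B <= k)%N & newton_series k = 0) ->
  forall n, newton_series n = 0.
Proof.
move=> inf0 n.
have zeros h : exists2 s : seq nat, uniq s &
    size s = h /\ forall k, k \in s -> newton_series k = 0.
  elim: h => [|h [s s_uniq [s_size s0]]]; first by exists [::].
  have [k le_k k0] := inf0 (\max_(i <- s) i).+1.
  exists (k :: s) => /=.
    rewrite s_uniq andbT; apply/negP=> k_s.
    by have := leq_trans le_k (leq_bigmax_seq (F := id) k k_s isT); rewrite ltnn.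
  by split=> [|i]; rewrite ?s_size // inE => /predU1P[-> //|/s0].
suff pdvd h : (p ^ h %| `|newton_series n|)%N.
  apply/eqP; rewrite -absz_eq0; apply/eqP.
  case E: `|newton_series n|%N => [//|a].
  have := dvdn_leq (ltn0Sn a); move/(_ (p ^ a.+1)%N); rewrite -E => /(_ (pdvd _)).
  by rewrite E leqNgt ltn_expl // prime_gt1.
have [s s_uniq [s_size s0]] := zeros h.*2.
set N := (maxn n (\max_(i <- s) i)).
have sN k : k \in s -> (k <= N)%N.
  by move=> k_s; rewrite leq_max (leq_bigmax_seq (F := id) k k_s isT) orbT.
have [||Q defP zQ] := @deflate_seq (newton_poly N) [seq k%:R | k <- s].
- by rewrite map_inj_uniq // => a b /eqP; rewrite eqr_nat => /eqP.
- apply/allP=> _ /mapP[k k_s ->]; rewrite /root newton_polyE ?sN //.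
  by rewrite s0 // mulr0.
have zN : ((p ^ (logn p N`! + h))%:Z %| N`!%:R * newton_series n)%Z.
  rewrite -newton_polyE ?leq_maxl // defP hornerM dvdz_mulr // horner_coef.
  apply: (big_ind (fun x => (_ %| x)%Z)) => [|x y|i _]; first exact: dvdz0.
    exact: rpredD.
  rewrite dvdz_mulr // zQ // => j; rewrite size_map s_size => le_j.
  by rewrite -[h]doubleK; apply: newton_poly_coef.
move: zN; rewrite natz dvdzE abszM !absz_nat expnD.
case E: (newton_series n == 0); first by rewrite (eqP E) dvdn0.
have abs_gt0 : (0 < `|newton_series n|)%N by rewrite absz_gt0 E.
rewrite -expnD !pfactor_dvdn ?muln_gt0 ?fact_gt0 // lognM ?fact_gt0 //.
by rewrite leq_add2l.
Qed.

End Hansel.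

(** * The Skolem-Mahler-Lech theorem *)

Section SkolemMahlerLech.

Definition zero_dichotomy (R : nzRingType) m (v : nat -> R) :=
  forall r, (forall B, exists2 k, (B <= k)%N & v (r + m * k)%N = 0) ->
  forall k, v (r + m * k)%N = 0.

(** Two powers of X agree modulo P by the pigeonhole principle, and X is
    invertible modulo P. *)
Lemma Xn_eq1_mod (F : finFieldType) (P : {poly F}) :
  P`_0 != 0 -> exists2 m, (0 < m)%N & (P %| 'X^m - 1)%R.
Proof.
move=> P0.
have nzP : P != 0 by apply: contraNneq P0 => ->; rewrite coef0.
pose M := #|{: 'rV[F]_(size P)}|.
pose g (i : 'I_M.+1) : 'rV[F]_(size P) := poly_rV ('X^i %% P).
have /injectivePn[i [j neq_ij eq_ij]] : ~~ injectiveb g.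
  by apply/negP=> /injectiveP/leq_card; rewrite card_ord ltnn.
wlog lt_ij : i j neq_ij eq_ij / (i < j)%N.
  move=> IH; case: (ltngtP i j) => [||/val_inj eq]; first exact: IH.
    by apply: IH => //; rewrite eq_sym.
  by rewrite eq eqxx in neq_ij.
exists (j - i)%N; rewrite ?subn_gt0 //.
have eq_mod : 'X^i %% P = 'X^j %% P.
  have sz k : (size ('X^k %% P)%R <= size P)%N by rewrite ltnW // ltn_modp.
  by rewrite -(poly_rV_K (sz i)) -(poly_rV_K (sz j)) -/(g i) -/(g j) eq_ij.
have cop : coprimep P 'X^i.
  by apply: coprimep_expr; rewrite coprimepX rootE horner_coef0.
rewrite -(Gauss_dvdpr _ cop) mulrBr mulr1 -exprD subnKC; last exact: ltnW.
by rewrite /dvdp modpD modpN eq_mod subrr.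
Qed.

(** Let p be an odd prime not dividing [P`_0].  Modulo p and P some power [X^m]
    is 1, say [X^m = p C + 1] modulo P with an integer polynomial C; expanding
    [X^(m k)] by the binomial formula exhibits [k |-> v (r + m k)] as a Newton
    series.  The modulus m depends on P only, which matters when this is applied
    to several coordinates at once. *)
Lemma skolem_mahler_lech_int (P : {poly int}) : P \is monic -> P`_0 != 0 ->
  exists2 m, (0 < m)%N & forall v,
    (forall n, shift_op P v n = 0) -> zero_dichotomy m v.
Proof.
move=> monP P0.
have [p p_gt p_pr] := prime_above (maxn 2 `|P`_0|).
have p_gt2 : (2 < p)%N by apply: leq_ltn_trans p_gt; rewrite leq_maxl.
pose f : {rmorphism int -> 'F_p} := intr.
have fE x : (f x == 0) = (p%:Z %| x)%Z by rewrite (dvdz_pcharf (pchar_Fp p_pr)).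
have [|m m_gt0 /dvdpP[S defS]] := @Xn_eq1_mod 'F_p (map_poly f P).
  rewrite coef_map /= fE dvdzE absz_nat; apply/negP=> /dvdn_leq.
  rewrite absz_gt0 P0 => /(_ isT); rewrite leqNgt; case/negP.
  by apply: leq_ltn_trans p_gt; rewrite leq_maxr.
exists m => // v Pv r inf0.
pose S' : {poly int} := map_poly (fun x : 'F_p => (x : nat)%:Z) S.
have fS' : map_poly f S' = S.
  apply/polyP=> i; rewrite coef_map coef_map_id0 //=.
  by rewrite -pmulrn natr_Zp.
have /polyOver_dvdzP[C defC] : ('X^m - 1 - S' * P) \is a polyOver (dvdz p).
  apply/polyOverP=> i; rewrite -[_ \in _]/(p%:Z %| _)%Z -fE -coef_map.
  by rewrite !rmorphB rmorphM /= map_polyXn rmorph1 fS' defS subrr coef0.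
have pow k : exists T, 'X^(m * k) = (p%:Z *: C + 1) ^+ k + T * P.
  exists ((\sum_(i < k) 'X^m ^+ (k.-1 - i) * (p%:Z *: C + 1) ^+ i) * S').
  apply/eqP; rewrite addrC -subr_eq exprM subrXX -defC; apply/eqP; ring.
have vE k : v (r + m * k)%N = newton_series p (fun i => shift_op (C ^+ i) v r) k.
  rewrite -shift_opXn; have [T ->] := pow k.
  rewrite shift_opD (dvd_shift_op T Pv) addr0 addrC exprDn shift_op_sum.
  apply: eq_bigr => i _; rewrite expr1n mul1r exprZn -scaler_nat scalerA.
  by rewrite shift_opZ !natz.
move=> k; rewrite vE; apply: newton_series_inf_zero => // B.
by have [k' le_k' v0] := inf0 B; exists k'; rewrite -?vE.
Qed.

(** Clearing denominators: if b is the leading coefficient of an integer multiple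
    of P and D a common denominator of the initial values, then [D b^n v n] is
    an integer sequence with a monic integer recurrence. *)
Lemma skolem_mahler_lech_rat (P : {poly rat}) : P`_0 != 0 ->
  exists2 m, (0 < m)%N & forall v,
    (forall n, shift_op P v n = 0) -> zero_dichotomy m v.
Proof.
move=> P0; have [q [a nz_a defP]] := rat_poly_scale P.
have q0 : q`_0 != 0.
  by apply: contraNneq P0; rewrite defP coefZ coef_map => -> /=; rewrite mulr0.
have nzq : q != 0 by apply: contraNneq q0 => ->; rewrite coef0.
set t := (size q).-1; have szq : size q = t.+1 by rewrite polySpred.
set b := lead_coef q; have nzb : b != 0 by rewrite lead_coef_eq0.
pose P' := \poly_(i < t.+1) (if (i == t)%N then 1 else q`_i * b ^+ (t - i).-1).
have szP' : size P' = t.+1 by rewrite size_poly_eq // eqxx oner_eq0.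
have P't : P'`_t = 1 by rewrite coef_poly ltnSn eqxx.
have monP' : P' \is monic by rewrite monicE /lead_coef szP' P't.
have P'0 : P'`_0 != 0.
  rewrite coef_poly /=; case: ifP => _; first exact: oner_neq0.
  by rewrite mulf_neq0 // expf_neq0.
have P'E i : (i <= t)%N -> b * P'`_i * b ^+ i = q`_i * b ^+ t.
  move=> le_it; rewrite coef_poly ltnS le_it; case: eqP => [->|/eqP ne].
    by rewrite mulr1 /b lead_coefE szq.
  have -> : t = ((t - i).-1 + 1 + i)%N by lia.
  have -> : ((t - i).-1 + 1 + i - i).-1 = (t - i).-1 by lia.
  by rewrite !exprD expr1; ring.
have [m m_gt0 dich] := skolem_mahler_lech_int monP' P'0.
exists m => // v Pv r inf0.
pose D := \prod_(i < t) denq (v i).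
pose v' n := D%:~R * b%:~R ^+ n * v n.
have nzD : D%:~R != 0 :> rat.
  by rewrite intr_eq0; apply/prodf_neq0 => i _; apply: denq_neq0.
have v'0 n : (v' n == 0) = (v n == 0).
  by rewrite !mulf_eq0 (negPf nzD) expf_eq0 intr_eq0 (negPf nzb) andbF.
have qv n : \sum_(i < t.+1) (q`_i)%:~R * v (n + i)%N = 0.
  have := Pv n; rewrite defP shift_opZ => /eqP.
  rewrite mulf_eq0 invr_eq0 intr_eq0 (negPf nz_a) /= => /eqP E; rewrite -[RHS]E.
  rewrite /shift_op size_map_inj_poly ?szq //; last exact: intr_inj.
  by apply: eq_bigr => i _; rewrite coef_map.
have rec n : \sum_(i < t.+1) (P'`_i)%:~R * v' (n + i)%N = 0.
  apply: (@mulfI _ b%:~R); rewrite ?intr_eq0 // mulr0.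
  transitivity (D%:~R * b%:~R ^+ (n + t) *
    \sum_(i < t.+1) (q`_i)%:~R * v (n + i)%N); last by rewrite qv mulr0.
  rewrite !mulr_sumr.
  apply: eq_bigr => i _; rewrite /v'.
  transitivity (((b * P'`_i * b ^+ i)%:~R * b%:~R ^+ n) * (D%:~R * v (n + i)%N)).
    by rewrite !rmorphM rmorphXn /= exprD; ring.
  rewrite P'E; last by rewrite -ltnS.
  by rewrite rmorphM rmorphXn /= exprD; ring.
have v'int n : v' n \is a Num.int.
  elim/ltn_ind: n => n IH; case: (ltnP n t) => [lt_nt | le_tn].
    rewrite /v' /D (bigD1 (Ordinal lt_nt)) //= rmorphM /=.
    set e : int := \prod_(_ < _ | _) _.
    have -> : (denq (v n))%:~R * e%:~R * b%:~R ^+ n * v n =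
        (numq (v n))%:~R * (e%:~R * b%:~R ^+ n) by rewrite numqE; ring.
    by rewrite !rpredM ?rpredX ?intr_int.
  have := rec (n - t)%N; rewrite big_ord_recr /= P't mul1r subnK // addrC.
  move/eqP; rewrite addr_eq0 => /eqP ->; rewrite rpredN rpred_sum // => i _.
  have lt_it : (i < t)%N := ltn_ord i.
  by rewrite rpredM ?intr_int // IH //=; lia.
have wE n : (numq (v' n))%:~R = v' n by rewrite numqK.
have Pw n : shift_op P' (fun n => numq (v' n)) n = 0.
  apply: (@intr_inj rat); rewrite /shift_op szP' rmorph_sum -[RHS](rec n).
  by apply: eq_bigr => i _; rewrite rmorphM /= wE.
have dw := dich _ Pw r; move=> k.
apply/eqP; rewrite -v'0 -wE dw //.
move=> B; have [k' leB /eqP] := inf0 B; rewrite -v'0 => /eqP v'k.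
by exists k'; rewrite ?v'k.
Qed.

(** Coordinates over the rationals satisfy the same rational recurrence. *)
Lemma skolem_mahler_lech_number_field (K : fieldExtType rat) (P : {poly rat})
    (v : nat -> K) :
  P`_0 != 0 -> (forall n, shift_op (map_poly (in_alg K) P) v n = 0) ->
  exists2 m, (0 < m)%N & zero_dichotomy m v.
Proof.
move=> P0 Pv; have [m m_gt0 dich] := skolem_mahler_lech_rat P0.
exists m => // r inf0 k.
have Pc h n : shift_op P (fun n => coord (vbasis {:K}) h (v n)) n = 0.
  have := congr1 (coord (vbasis {:K}) h) (Pv n).
  rewrite linear0 /shift_op size_map_poly linear_sum => E; rewrite -[RHS]E.
  by apply: eq_bigr => i _; rewrite coef_map /= mulr_algl linearZ.
rewrite (coord_vbasis (memvf (v _))) big1 // => h _.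
rewrite (dich _ (Pc h)) ?scale0r // => B.
by have [k' leB v0] := inf0 B; exists k'; rewrite // v0 linear0.
Qed.

End SkolemMahlerLech.

(** * Exponential polynomials and non-degeneracy *)

Section ExponentialPolynomials.

Variable F : numFieldType.
Implicit Types (G : F -> Prop) (u v c : nat -> F) (s t : seq F).

Definition kills s u := forall n, shift_op (\prod_(z <- s) ('X - z%:P)) u n = 0.

Lemma kills_nil u : kills [::] u -> forall n, u n = 0.
Proof. by move=> u0 n; rewrite -(shift_op1 u) -[RHS](u0 n) big_nil. Qed.

Lemma kills0 s u : (forall n, u n = 0) -> kills s u.
Proof. by move=> u0 n; apply: shift_op_seq0. Qed.

Lemma shift_op_XsubC z u n : shift_op ('X - z%:P) u n = u n.+1 - z * u n.
Proof.
rewrite -polyCN shift_opD shift_opC -['X]expr1 shift_opXn addn1 mulNr //.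
Qed.

Lemma kills_cons z s u : kills (z :: s) u -> kills s (fun n => u n.+1 - z * u n).
Proof.
move=> zs_u n; rewrite -(zs_u n) big_cons mulrC shift_opM.
by apply: eq_shift_op => i; rewrite shift_op_XsubC.
Qed.

Lemma cons_kills z s u : kills s (fun n => u n.+1 - z * u n) -> kills (z :: s) u.
Proof.
move=> s_u n; rewrite -(s_u n) big_cons mulrC shift_opM.
by apply: eq_shift_op => i; rewrite shift_op_XsubC.
Qed.

Lemma kills_catl s t u : kills s u -> kills (s ++ t) u.
Proof. by move=> s_u n; rewrite big_cat /= mulrC dvd_shift_op. Qed.

Lemma kills_catr s t u : kills t u -> kills (s ++ t) u.
Proof. by move=> s_u n; rewrite big_cat /= dvd_shift_op. Qed.

Lemma kills_succ s u : kills s u -> kills s (fun n => u n.+1).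
Proof. by move=> s_u n; rewrite shift_op_shift. Qed.

(** Exponential polynomials with bases in G.  The multiplicities of a base are
    its multiplicities in s, so no polynomial coefficients are written down. *)
Definition exp_poly G u := exists2 s, (forall z, z \in s -> G z) & kills s u.

Lemma eq_exp_poly G u v : u =1 v -> exp_poly G u -> exp_poly G v.
Proof.
move=> uv [s Gs s_u]; exists s => // n; rewrite -(s_u n).
by apply: eq_shift_op => i; rewrite uv.
Qed.

Lemma exp_poly0 G : exp_poly G (fun=> 0).
Proof. by exists [::] => //; apply: kills0. Qed.

Lemma exp_polyD G u v :
  exp_poly G u -> exp_poly G v -> exp_poly G (fun n => u n + v n).
Proof.
move=> [s Gs s_u] [t Gt t_v]; exists (s ++ t) => [z|n].
  by rewrite mem_cat => /orP[/Gs|/Gt].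
by rewrite shift_op_seqD kills_catl ?kills_catr ?addr0.
Qed.

Lemma exp_polyZ G a u : exp_poly G u -> exp_poly G (fun n => a * u n).
Proof. by move=> [s Gs s_u]; exists s => // n; rewrite shift_op_seqZ s_u mulr0. Qed.

Lemma exp_poly1 G : G 1 -> exp_poly G (fun=> 1).
Proof.
move=> G1; exists [:: 1] => [z|]; first by rewrite inE => /eqP->.
by apply: cons_kills => n; rewrite shift_op_seq0 // => m; rewrite mulr1 subrr.
Qed.

(** With E the shift, [(E - x y)(u v) = (E - x)u * E v + x u * (E - y)v], and both
    products on the right have a shorter annihilator in one factor. *)
Lemma exp_polyM G u v : (forall x y, G x -> G y -> G (x * y)) ->
  exp_poly G u -> exp_poly G v -> exp_poly G (fun n => u n * v n).
Proof.
move=> GM [s Gs s_u] [t Gt t_v].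
have [N leN] := ubnP (size s + size t)%N.
elim: N => // N IH in s t u v Gs Gt s_u t_v leN *.
case: s Gs s_u leN => [|x s] Gs s_u leN.
  apply: eq_exp_poly (exp_poly0 G) => n; by rewrite (kills_nil s_u) mul0r.
case: t Gt t_v leN => [|y t] Gt t_v leN.
  apply: eq_exp_poly (exp_poly0 G) => n; by rewrite (kills_nil t_v) mulr0.
have Gs' z : z \in s -> G z by move=> zs; apply: Gs; rewrite inE zs orbT.
have Gt' z : z \in t -> G z by move=> zt; apply: Gt; rewrite inE zt orbT.
have H1 := IH _ _ _ _ Gs' Gt (kills_cons s_u) (kills_succ t_v) leN.
have lt2 : (size (x :: s) + size t < N)%N by rewrite /= addnS in leN.
have H2 := exp_polyZ x (IH _ _ _ _ Gs Gt' s_u (kills_cons t_v) lt2).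
have [w Gw w_uv] := exp_polyD H1 H2.
exists (x * y :: w) => [z|].
  rewrite inE => /predU1P[->|/Gw//]; apply: GM; [apply: Gs|apply: Gt]; exact: mem_head.
apply: cons_kills => n; rewrite -(w_uv n); apply: eq_shift_op => m; ring.
Qed.

Lemma exp_poly_sum G (I : Type) (r : seq I) (us : I -> nat -> F) :
  (forall i, exp_poly G (us i)) -> exp_poly G (fun n => \sum_(i <- r) us i n).
Proof.
move=> Gus; elim: r => [|i r IH].
  by apply: eq_exp_poly (exp_poly0 G) => n; rewrite big_nil.
by apply: eq_exp_poly (exp_polyD (Gus i) IH) => n; rewrite big_cons.
Qed.

Lemma exp_poly_prod G (I : Type) (r : seq I) (us : I -> nat -> F) :
  G 1 -> (forall x y, G x -> G y -> G (x * y)) ->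
  (forall i, exp_poly G (us i)) -> exp_poly G (fun n => \prod_(i <- r) us i n).
Proof.
move=> G1 GM Gus; elim: r => [|i r IH].
  by apply: eq_exp_poly (exp_poly1 G1) => n; rewrite big_nil.
by apply: eq_exp_poly (exp_polyM GM (Gus i) IH) => n; rewrite big_cons.
Qed.

Lemma shift_op_comp_Xn (P : {poly F}) c x y n :
  shift_op P (fun k => c (x * k + y)%N) n = shift_op (P \Po 'X^x) c (x * n + y)%N.
Proof.
rewrite comp_polyE shift_op_sum; apply: eq_bigr => i _.
by rewrite shift_opZ -exprM shift_opXn mulnDr addnAC.
Qed.

(** ['X - z] divides ['X^x - z^x], and the substitution of ['X^x] for ['X] turns
    ['X - z^x] into the latter. *)
Lemma kills_subseq s c x y :
  kills s c -> kills [seq z ^+ x | z <- s] (fun n => c (x * n + y)%N).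
Proof.
move=> s_c n; rewrite shift_op_comp_Xn rmorph_prod big_map /=.
have [Q ->] : exists Q : {poly F}, \prod_(z <- s) (('X - (z ^+ x)%:P) \Po 'X^x) =
    Q * \prod_(z <- s) ('X - z%:P).
  elim: (s) => [|z s' [Q IH]]; first by exists 1; rewrite !big_nil mulr1.
  exists (Q * \sum_(i < x) 'X^(x.-1 - i) * z%:P ^+ i).
  rewrite !big_cons IH comp_polyB comp_polyX comp_polyC polyC_exp subrXX; ring.
by rewrite dvd_shift_op.
Qed.

Lemma exp_poly_subseq G s c x y : kills s c -> (forall z, z \in s -> G (z ^+ x)) ->
  exp_poly G (fun n => c (x * n + y)%N).
Proof.
move=> s_c Gs; exists [seq z ^+ x | z <- s]; last exact: kills_subseq.
by move=> _ /mapP[z zs ->]; apply: Gs.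
Qed.

Lemma coprime_kills (P Q : {poly F}) u : coprimep P Q ->
  (forall n, shift_op P u n = 0) -> (forall n, shift_op Q u n = 0) ->
  forall n, u n = 0.
Proof.
case/Bezout_eq1_coprimepP=> -[A B] /= AB Pu Qu n.
by rewrite -(shift_op1 u) -AB shift_opD !dvd_shift_op ?addr0.
Qed.

(** Induction on the annihilator.  If u is killed by z :: s and vanishes along
    the progression, then (E^m - z^m) u is killed by s and vanishes along it
    too, hence is zero.  Write X^m - z^m = (X - z) g.  No w in s is a root of g:
    w^m = z^m forces w = z by hypothesis, and z is a simple root of X^m - z^m.
    So g is coprime to the annihilator of (E - z) u given by s, which forces
    (E - z) u = 0, and u is geometric. *)
Lemma exp_poly_nondegenerate G u m r :
  (forall x, G x -> x != 0) ->
  (forall x y, G x -> G y -> x ^+ m = y ^+ m -> x = y) -> (0 < m)%N ->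
  exp_poly G u -> (forall n, u (m * n + r)%N = 0) -> forall n, u n = 0.
Proof.
move=> G0 Gtf m_gt0 [s]; elim: s u => [|z s IH] u Gs s_u um.
  exact: kills_nil.
have Gz : G z by apply: Gs; apply: mem_head.
have Gs' y : y \in s -> G y by move=> ys; apply: Gs; rewrite inE ys orbT.
pose g : {poly F} := \sum_(i < m) 'X^(m.-1 - i) * z%:P ^+ i.
have defg : 'X^m - (z ^+ m)%:P = ('X - z%:P) * g by rewrite polyC_exp subrXX.
have gu n : shift_op g (fun k => u k.+1 - z * u k) n = 0.
  transitivity (shift_op ('X^m - (z ^+ m)%:P) u n).
    rewrite defg mulrC shift_opM.
    by apply: eq_shift_op => k; rewrite shift_op_XsubC.
  apply: (IH _ Gs') => [k|k].
    rewrite -shift_opM defg mulrA mulrC -[_ * ('X - _)]mulrC.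
    by rewrite -(big_cons _ _ _ _ xpredT (fun w => 'X - w%:P)) /= dvd_shift_op.
  rewrite -polyCN shift_opD shift_opXn shift_opC um mulr0 addr0.
  by rewrite addnC addnA -mulnS um.
have cop : coprimep g (\prod_(w <- s) ('X - w%:P)).
  elim: (s) Gs' => [|w s' IHs] Gs'; first by rewrite big_nil coprimep1.
  rewrite big_cons coprimepMr IHs ?andbT; last first.
    by move=> y ys; apply: Gs'; rewrite inE ys orbT.
  rewrite coprimep_XsubC; apply/negP=> gw.
  have wz : w = z.
    apply: Gtf => //; first by apply: Gs'; apply: mem_head.
    apply/eqP; rewrite -subr_eq0.
    have := congr1 (fun p => p.[w]) defg.
    by rewrite hornerM (rootP gw) mulr0 !hornerE => ->.
  move: gw; rewrite wz /root /g horner_sum.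
  under eq_bigr => i _.
    rewrite hornerM hornerXn horner_exp hornerC -exprD.
    rewrite subnK; last by rewrite -ltnS prednK.
  over.
  rewrite sumr_const card_ord mulrn_eq0 expf_eq0 (negPf (G0 _ Gz)) andbF orbF.
  by case: (m) m_gt0.
have u1 n : u n.+1 = z * u n.
  by apply/eqP; rewrite -subr_eq0 (coprime_kills cop gu) //; apply: kills_cons.
have uE n : u n = z ^+ n * u 0.
  by elim: n => [|n IHn]; rewrite ?mul1r // u1 IHn mulrA -exprS.
have u0 : u 0 = 0.
  have := um 0; rewrite uE => /eqP; rewrite mulf_eq0 expf_eq0.
  by rewrite (negPf (G0 _ Gz)) andbF => /eqP.
by move=> n; rewrite uE u0 mulr0.
Qed.

End ExponentialPolynomials.

(** * Orders of roots of unity among products of eigenvalues *)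

Section TorsionBound.

(** A prime power p^a exactly dividing n satisfies p^a / 2 <= phi(p^a) <= D. *)
Lemma dvdn_fact_totient n D :
  (0 < n)%N -> (totient n <= D)%N -> (n %| (2 * D)`!)%N.
Proof.
move=> n_gt0 le_nD; apply/(dvdn_partP _ n_gt0) => p.
rewrite -p_part_gt1 => np_gt1; apply: dvdn_fact.
rewrite (leq_trans _ np_gt1) //=; move: np_gt1.
have le_tot : (totient n`_p <= D)%N.
  apply: leq_trans le_nD.
  rewrite -[X in (_ <= totient X)%N](partnC p n_gt0).
  by rewrite totient_coprime ?coprime_partC // leq_pmulr // totient_gt0 part_gt0.
case: (boolP (p \in \pi(n))) => [|/negPf npi]; last by rewrite p_part_gt1 npi.
rewrite mem_primes => /and3P[p_pr _ _] np_gt1.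
move: le_tot np_gt1; rewrite p_part; case: (logn p n) => [|e]; first by [].
rewrite totient_pfactor //= expnS => le_tot _.
have p_gt1 := prime_gt1 p_pr; apply: leq_trans (leq_mul (leqnn 2) le_tot).
by rewrite mulnA leq_mul2r; apply/orP; right; lia.
Qed.

Variables (T : finType) (g : T -> algC).

Definition rat_span y := exists a : T -> rat, y = \sum_i ratr (a i) * g i.

Lemma rat_span_gen i : rat_span (g i).
Proof.
exists (fun k => (k == i)%:R); rewrite (bigD1 i) //= eqxx rmorph1 mul1r.
by rewrite big1 ?addr0 // => k /negPf->; rewrite rmorph0 mul0r.
Qed.

Lemma rat_spanD x y : rat_span x -> rat_span y -> rat_span (x + y).
Proof.
move=> [a ->] [b ->]; exists (fun i => a i + b i); rewrite -big_split /=.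
by apply: eq_bigr => i _; rewrite rmorphD mulrDl.
Qed.

Lemma rat_span0 : rat_span 0.
Proof.
by exists (fun=> 0); rewrite big1 // => i _; rewrite rmorph0 mul0r.
Qed.

Lemma rat_spanZ q x : rat_span x -> rat_span (ratr q * x).
Proof.
move=> [a ->]; exists (fun i => q * a i); rewrite mulr_sumr.
by apply: eq_bigr => i _; rewrite rmorphM mulrA.
Qed.

Lemma rat_span_sum (I : Type) (r : seq I) (F : I -> algC) :
  (forall i, rat_span (F i)) -> rat_span (\sum_(i <- r) F i).
Proof.
move=> FS; elim: r => [|i r IH]; first by rewrite big_nil; apply: rat_span0.
by rewrite big_cons; apply: rat_spanD.
Qed.

Definition stabilizes_span z := forall y, rat_span y -> rat_span (z * y).

Lemma stabilizes_spanP z : (forall i, rat_span (z * g i)) -> stabilizes_span z.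
Proof.
move=> zg _ [a ->]; rewrite mulr_sumr; apply: rat_span_sum => i.
by rewrite mulrCA; apply: rat_spanZ.
Qed.

Lemma stabilizes_spanM x y :
  stabilizes_span x -> stabilizes_span y -> stabilizes_span (x * y).
Proof. by move=> Sx Sy z Sz; rewrite -mulrA; apply/Sx/Sy. Qed.

Lemma stabilizes_span1 : stabilizes_span 1.
Proof. by move=> y; rewrite mul1r. Qed.

Lemma stabilizes_spanX x n : stabilizes_span x -> stabilizes_span (x ^+ n).
Proof.
move=> Sx; elim: n => [|n IH]; first exact: stabilizes_span1.
by rewrite exprS; apply: stabilizes_spanM.
Qed.

Lemma stabilizes_span_sum (I : Type) (r : seq I) (F : I -> algC) :
  (forall i, stabilizes_span (F i)) -> stabilizes_span (\sum_(i <- r) F i).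
Proof.
by move=> FS y Sy; rewrite mulr_suml; apply: rat_span_sum => i; apply: FS.
Qed.

Lemma stabilizes_span_prod (I : Type) (r : seq I) (F : I -> algC) :
  (forall i, stabilizes_span (F i)) -> stabilizes_span (\prod_(i <- r) F i).
Proof.
move=> FS; elim: r => [|i r IH].
  by rewrite big_nil; apply: stabilizes_span1.
by rewrite big_cons; apply: stabilizes_spanM.
Qed.

(** An element that stabilises the rational span of finitely many complex
    numbers is an eigenvalue of a rational matrix of that size. *)
Lemma stabilizer_root z y : y != 0 -> rat_span y -> stabilizes_span z ->
  exists p : {poly rat}, size p = #|T|.+1 /\ root (map_poly ratr p) z.
Proof.
move=> nz_y [b defy] Sz.
have /fin_all_exists[A zA] i : exists a : T -> rat, z * g i = \sum_j ratr (a j) * g j.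
  exact: Sz (rat_span_gen i).
pose M : 'M[rat]_#|T| := \matrix_(j, i) A (enum_val i) (enum_val j).
pose v : 'rV[algC]_#|T| := \row_i g (enum_val i).
exists (char_poly M); rewrite size_char_poly map_char_poly; split=> //.
rewrite -eigenvalue_root_char; apply/eigenvalueP; exists v.
  apply/rowP=> i; rewrite !mxE zA (reindex (@enum_val T T)) /=; last first.
    by apply: onW_bij; apply: enum_val_bij.
  by apply: eq_bigr => j _; rewrite !mxE mulrC.
apply: contraNneq nz_y => v0; rewrite defy big1 // => i _.
have := congr1 (fun w : 'rV_#|T| => w 0 (enum_rank i)) v0.
by rewrite !mxE enum_rankK => ->; rewrite mulr0.
Qed.

(** The cyclotomic polynomial, of degree phi(n), is the minimal polynomial of a
    primitive n-th root of unity. *)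
Lemma stabilizer_unity_root_order z y n : y != 0 -> rat_span y ->
  stabilizes_span z -> n.-primitive_root z -> (n %| (2 * #|T|)`!)%N.
Proof.
move=> nz_y Sy Sz prim_z; have n_gt0 := prim_order_gt0 prim_z.
apply: dvdn_fact_totient => //.
have [p [szp pz]] := stabilizer_root nz_y Sy Sz.
have [q [defq _] qP] := minCpolyP z.
have nzp : p != 0 by rewrite -size_poly_gt0 szp.
move: pz; rewrite qP => /(dvdp_leq nzp); rewrite szp.
have := size_cyclotomic z n; rewrite -(minCpoly_cyclotomic prim_z) defq.
by rewrite size_map_poly => ->; rewrite ltnS.
Qed.

End TorsionBound.

Section EigenvalueGroup.

Variables (K : fieldExtType rat) (iota : {rmorphism K -> algC}).
Variables (chi : {poly K}) (lam : seq algC).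
Hypothesis monic_chi : chi \is monic.
Hypothesis lam_chi : forall z, z \in lam -> root (map_poly iota chi) z.
Hypothesis chi0 : chi`_0 != 0.

Let N := \dim {:K}.
Let m := size lam.
Let r := (size chi).-1.
Let T := ('I_N * {ffun 'I_m -> 'I_r})%type.
(** The products of a basis of K with monomials of partial degrees below r in
    the roots of chi span the ring generated by K and these roots. *)
Let monom (f : 'I_m -> nat) := \prod_(i < m) lam`_i ^+ f i.
Let g (x : T) : algC := iota (vbasis {:K})`_x.1 * monom (fun i => x.2 i).

Let size_chi : size chi = r.+1.
Proof. by rewrite prednK // size_poly_gt0 monic_neq0. Qed.

Let span_monom x (f : 'I_m -> nat) : (forall i, f i < r)%N ->
  rat_span g (iota x * monom f).
Proof.
move=> f_lt; rewrite (coord_vbasis (memvf x)) rmorph_sum mulr_suml.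
apply: rat_span_sum => h.
rewrite -mulr_algl rmorphM.
rewrite -[iota _%:A]/((iota \o in_alg K) _) fmorph_eq_rat -mulrA.
apply: rat_spanZ.
have -> : iota (vbasis {:K})`_h * monom f = g (h, [ffun i => Ordinal (f_lt i)]).
  by congr (_ * _); apply: eq_bigr => i _; rewrite ffunE.
exact: rat_span_gen.
Qed.

Let stab_iota x : stabilizes_span g (iota x).
Proof.
apply: stabilizes_spanP => -[h f]; rewrite mulrA -rmorphM.
by apply: span_monom => i.
Qed.

Let chi_lam (i : 'I_m) :
  lam`_i ^+ r = - \sum_(k < r) iota chi`_k * lam`_i ^+ k.
Proof.
have /rootP := lam_chi (mem_nth 0 (ltn_ord i)).
rewrite horner_coef size_map_poly size_chi big_ord_recr /= coef_map /=.
have -> : chi`_r = 1 by rewrite -(monicP monic_chi) lead_coefE size_chi.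
rewrite rmorph1 mul1r addrC => /eqP; rewrite addr_eq0 => /eqP ->.
by congr (- _); apply: eq_bigr => k _; rewrite coef_map.
Qed.

Let stab_lam (i : 'I_m) : stabilizes_span g lam`_i.
Proof.
apply: stabilizes_spanP => -[h f]; rewrite /g /= mulrCA.
pose rest := \prod_(j | j != i) lam`_j ^+ f j.
have split_monom k : lam`_i ^+ k * rest = monom (fun j => if j == i then k else f j).
  rewrite /monom (bigD1 i) //= eqxx; congr (_ * _).
  by apply: eq_bigr => j /negPf->.
have low k y : (k < r)%N -> rat_span g (iota y * (lam`_i ^+ k * rest)).
  by move=> lt_kr; rewrite split_monom; apply: span_monom => j; case: eqP.
have -> : lam`_i * monom (fun j => f j) = lam`_i ^+ (f i).+1 * rest.
  by rewrite /monom (bigD1 i) //= exprS mulrA.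
have := ltn_ord (f i); rewrite leq_eqVlt => /predU1P[-> | /low //].
rewrite chi_lam mulNr mulr_suml -sumrN mulr_sumr; apply: rat_span_sum => k.
by rewrite -!mulrA -mulNr mulrA -rmorphN -rmorphM; apply: low.
Qed.

Let stab_lamV (i : 'I_m) : stabilizes_span g (lam`_i)^-1.
Proof.
have /rootP := lam_chi (mem_nth 0 (ltn_ord i)).
rewrite horner_coef size_map_poly size_chi big_ord_recl /= coef_map /= mulr1.
under eq_bigr => k _ do rewrite coef_map /bump /= add1n exprS mulrCA.
rewrite -mulr_sumr; set S := (X in lam`_i * X) => /eqP.
rewrite addr_eq0 => /eqP eq_chi0.
have nz_i : lam`_i != 0.
  apply: contraNneq chi0 => lam0; move: eq_chi0.
  by rewrite lam0 mul0r oppr0 => /eqP; rewrite fmorph_eq0.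
have -> : (lam`_i)^-1 = iota (- (chi`_0)^-1) * S.
  apply: (mulfI nz_i); rewrite mulfV // mulrCA.
  rewrite -[_ * S]opprK -eq_chi0 rmorphN mulrNN -rmorphM mulVf //.
  by rewrite rmorph1.
apply: stabilizes_spanM; first exact: stab_iota.
apply: stabilizes_span_sum => k; apply: stabilizes_spanM; first exact: stab_iota.
exact: stabilizes_spanX.
Qed.

(** The inverse of a root is a polynomial in that root because [chi`_0] is
    non-zero, so the whole multiplicative group stabilises the span. *)
Lemma torsion_order_dvd_fact n z (t : nat) : in_mul_group lam z ->
  n.-primitive_root z -> ((size chi).-1 <= t)%N -> (size lam <= t)%N ->
  (n %| (2 * (\dim {:K} * t ^ t))`!)%N.
Proof.
move=> [e defz] prim_z le_rt le_mt.
have stab_z : stabilizes_span g z.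
  rewrite defz; apply: stabilizes_span_prod => i.
  case: (e i) => k; first exact: stabilizes_spanX.
  by rewrite NegzE -exprnN -exprVn; apply: stabilizes_spanX.
have r_gt0 : 'I_m -> (0 < r)%N.
  move=> i; rewrite lt0n; apply/negP => /eqP r0.
  by have /eqP := chi_lam i; rewrite r0 big_ord0 oppr0 expr0 oner_eq0.
have span1 : rat_span g 1.
  have <- : iota 1 * monom (fun=> 0%N) = 1.
    by rewrite rmorph1 mul1r /monom big1 // => i _; rewrite expr0.
  exact: span_monom.
have dvdT := stabilizer_unity_root_order (oner_neq0 _) span1 stab_z prim_z.
apply: dvdn_trans dvdT _; rewrite card_prod card_ord card_ffun !card_ord.
have fact_dvd a b : (a <= b)%N -> (a`! %| b`!)%N.
  by move=> le_ab; rewrite -(bin_fact le_ab) mulnCA dvdn_mulr.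
apply: fact_dvd; rewrite !leq_mul2l; apply/orP; right; apply/orP; right.
rewrite -/N -/m -/r in le_rt le_mt *.
case: t le_rt le_mt => [|t] le_rt le_mt.
  by move: le_mt; rewrite leqn0 => /eqP->; rewrite expn0.
apply: leq_trans (leq_pexp2l _ le_mt) => //.
by case: (m) => // k; rewrite leq_exp2r.
Qed.

End EigenvalueGroup.

(** * Digits and determinants *)

Section Digits.

Local Open Scope nat_scope.

(** The digits of [m < t ^ q] in base t enumerate the functions from ['I_q] to
    ['I_t], so that sums over functions become bounded sums over numbers. *)
Definition digit t a m := m %/ t ^ a %% t.

Lemma ltn_digit t a m q : m < t ^ q -> a < q -> digit t a m < t.
Proof.
move=> lt_m lt_a; rewrite ltn_pmod //; case: t lt_m => // lt_m.
by move: lt_m; rewrite exp0n // (leq_ltn_trans _ lt_a).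
Qed.

Lemma digit_onto t q (f : nat -> nat) : (forall a, a < q -> f a < t) ->
  exists2 m, m < t ^ q & forall a, a < q -> digit t a m = f a.
Proof.
elim: q => [|q IH] f_lt; first by exists 0.
have [|m lt_m mf] := IH; first by move=> a lt_a; rewrite f_lt // ltnW.
have t_gt0 : 0 < t by apply: leq_ltn_trans (f_lt q _).
exists (m + f q * t ^ q) => [|a].
  rewrite expnS; apply: leq_trans (_ : (f q).+1 * t ^ q <= _).
    by rewrite mulSn ltn_add2r.
  by rewrite leq_mul2r f_lt ?orbT.
rewrite ltnS leq_eqVlt => /predU1P[-> | lt_a].
  rewrite /digit addnC divnMDl ?expn_gt0 ?t_gt0 // divn_small //.
  by rewrite addn0 modn_small ?f_lt.
rewrite -(mf a lt_a) /digit.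
have -> : f q * t ^ q = (f q * t ^ (q - a.+1) * t) * t ^ a.
  by rewrite -!mulnA -expnS -expnD subnK.
by rewrite addnC divnMDl ?expn_gt0 ?t_gt0 // modnMDl.
Qed.

End Digits.

Section ScaledDeterminant.

Variable K : fieldType.
Hypothesis charK : [pchar K] =i pred0.

Lemma sum_digits q t (Phi : nat -> K) (Psi : {ffun 'I_q -> 'I_t} -> K) :
  (forall m (f : {ffun 'I_q -> 'I_t}), (m < t ^ q)%N ->
     (forall a : 'I_q, digit t a m = f a) ->
     Phi m = Psi f) ->
  \sum_(0 <= m < t ^ q) Phi m = \sum_f Psi f.
Proof.
move=> PhiPsi; rewrite big_mkord.
have code (f : {ffun 'I_q -> 'I_t}) :
    exists m : 'I_(t ^ q), [forall a : 'I_q, digit t a m == f a].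
  pose f' a := oapp (fun i => f i : nat) 0%N (insub a).
  have [|m lt_m mf] := @digit_onto t q f'.
    by move=> a lt_a; rewrite /f' insubT /=.
  by exists (Ordinal lt_m); apply/forallP=> a; rewrite /= mf // /f' valK.
pose g f := xchoose (code f).
have gP f (a : 'I_q) : digit t a (g f) = f a.
  by apply/eqP; apply: (forallP (xchooseP (code f))).
have g_inj : injective g.
  by move=> f f' eq_g; apply/ffunP=> a; apply: val_inj; rewrite /= -!gP eq_g.
rewrite (reindex g) /=; last first.
  by apply/onW_bij/inj_card_bij; rewrite // card_ffun !card_ord.
by apply: eq_bigr => f _; apply: PhiPsi.
Qed.

(** A Cauchy-Binet expansion: with B a Vandermonde matrix the coefficients of
    the products of entries of A are explicit products of differences, and no
    signs of permutations have to be computed. *)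
Lemma det_mul_expand q (A B : 'M[K]_q) : \det (A *m B) =
  \sum_(f : {ffun 'I_q -> 'I_q}) \det (\matrix_(i, j) B (f i) j) * \prod_i A i (f i).
Proof.
transitivity (\sum_(f : {ffun 'I_q -> 'I_q}) \sum_(s : 'S_q)
    (-1) ^+ s * \prod_i (A i (f i) * B (f i) (s i))).
  rewrite exchange_big; apply: eq_bigr => /= s _; rewrite -big_distrr /=.
  congr (_ * _); rewrite -(bigA_distr_bigA (fun i k => A i k * B k (s i))) /=.
  by apply: eq_bigr => i _; rewrite mxE.
apply: eq_bigr => f _; rewrite big_distrl; apply: eq_bigr => s _ /=.
rewrite big_split /= mulrCA mulrC; congr (_ * _ * _).
by apply: eq_bigr => i _; rewrite mxE.
Qed.

Definition vandermonde_product q (f : nat -> nat) : K :=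
  \prod_(0 <= i < q) \prod_(0 <= j < q) if (i < j)%N then (f j)%:R - (f i)%:R else 1.

Lemma vandermonde_productE q (f : nat -> nat) :
  vandermonde_product q f = \det (\matrix_(i < q, j < q) (f i)%:R ^+ j : 'M[K]_q).
Proof.
rewrite -det_tr (_ : _^T = Vandermonde q (\row_(i < q) (f i)%:R)); last first.
  by apply/matrixP=> i j; rewrite !mxE.
rewrite det_Vandermonde /vandermonde_product big_mkord.
apply: eq_bigr => i _; rewrite big_mkord [RHS]big_mkcond.
by apply: eq_bigr => j _; rewrite !mxE.
Qed.

Lemma vandermonde_product_neq0 q : vandermonde_product q id != 0.
Proof.
rewrite prodf_seq_neq0; apply/allP=> i _; rewrite implyTb.
rewrite prodf_seq_neq0; apply/allP=> j _; rewrite implyTb.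
case: ltnP => [lt_ij|_]; last exact: oner_neq0.
rewrite -natrB 1?ltnW //; have /pcharf0P -> := charK.
by rewrite subn_eq0 -ltnNge.
Qed.

(** A determinant up to a non-zero factor, as an expression in bounded sums and
    products only. *)
Definition scaled_det q (A : nat -> nat -> K) : K :=
  \sum_(0 <= m < q ^ q) vandermonde_product q (fun a => digit q a m) *
    \prod_(0 <= a < q) A a (digit q a m).

Lemma scaled_detE q A : scaled_det q A =
  vandermonde_product q id * \det (\matrix_(a < q, b < q) A a b).
Proof.
rewrite vandermonde_productE mulrC -det_mulmx det_mul_expand.
apply: sum_digits => m f lt_m mf; congr (_ * _).
  rewrite vandermonde_productE; congr (\det _); apply/matrixP=> i j.
  by rewrite !mxE mf.
by rewrite big_mkord; apply: eq_bigr => i _; rewrite mxE mf.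
Qed.

End ScaledDeterminant.

(** * Finite-dimensional shift-invariant spaces of sequences *)

Section FiniteDimensional.

Variable K : fieldType.

Lemma recurrence_zero (t : nat) (gamma u : nat -> K) : C_recurrence t gamma u ->
  (forall n, (n < t)%N -> u n = 0) -> forall n, u n = 0.
Proof.
move=> [gt0 rec] u0; elim/ltn_ind => n IH.
case: (ltnP n t) => [|le_tn]; first exact: u0.
have := rec (n - t)%N; rewrite big_ord_recr /= subnK // big1 ?add0r.
  by move/eqP; rewrite mulf_eq0 (negPf gt0) => /eqP.
move=> i _; have lt_i := ltn_ord i; rewrite IH ?mulr0 //; lia.
Qed.

(** Cayley-Hamilton for the matrix of the shift on the span of g. *)
Lemma finite_dim_recurrence (T : finType) (g : T -> nat -> K) :
  (forall i, exists a : T -> K, forall n, g i n.+1 = \sum_j a j * g j n) ->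
  exists gamma, forall i, C_recurrence #|T| gamma (g i).
Proof.
move=> /fin_all_exists[a ga].
case cardT : #|T| => [|m].
  exists (fun=> 1) => i; have := fintype0 i; by rewrite cardT.
pose val_of i := enum_val (cast_ord (esym cardT) i).
pose M : 'M[K]_m.+1 := \matrix_(i, j) a (val_of i) (val_of j).
pose G n : 'cV[K]_m.+1 := \col_i g (val_of i) n.
have MG n : M *m G n = G n.+1.
  apply/colP=> i; rewrite !mxE ga (reindex val_of) /=.
    by apply: eq_bigr => k _; rewrite !mxE.
  exists (fun x => cast_ord cardT (enum_rank x)) => x _.
    by rewrite /val_of enum_valK cast_ordKV.
  by rewrite /val_of cast_ordK enum_rankK.
have act P n i : (horner_mx M P *m G n) i 0 =
    shift_op P (g (val_of i)) n.
  elim/poly_ind: P n => [|P c IH] n.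
    by rewrite rmorph0 mul0mx mxE shift_op0p.
  rewrite rmorphD rmorphM /= horner_mx_X horner_mx_C mulmxDl mxE shift_opD.
  rewrite -mulmxA MG IH shift_opMX shift_op_shift shift_opC mul_scalar_mx.
  by rewrite !mxE.
exists (fun i => (char_poly M)`_i) => x; split.
  have /monicP := char_poly_monic M.
  by rewrite lead_coefE size_char_poly /= => ->; apply: oner_neq0.
move=> n; have := act (char_poly M) n (cast_ord cardT (enum_rank x)).
rewrite Cayley_Hamilton mul0mx mxE /val_of cast_ordK enum_rankK /shift_op.
by rewrite size_char_poly.
Qed.

End FiniteDimensional.

Section ProductSpan.

Variables (K : fieldType) (c : nat -> K) (t : nat) (gamma : nat -> K).
Hypothesis rec_c : C_recurrence t gamma c.

(** Solving the recurrence for its last term, repeatedly. *)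
Lemma shift_expansion y :
  exists C : 'I_t -> K, forall z, c (y + z)%N = \sum_b C b * c (z + b)%N.
Proof.
have [gt0 rec] := rec_c; elim/ltn_ind: y => y IH; case: (ltnP y t) => [lt_y|le_t].
  exists (fun b => (b == Ordinal lt_y)%:R) => z.
  rewrite (bigD1 (Ordinal lt_y)) //= eqxx mul1r addnC big1 ?addr0 //.
  by move=> b /negPf->; rewrite mul0r.
have /fin_all_exists[C cC] (i : 'I_t) : exists C : 'I_t -> K,
    forall z, c (y - t + i + z)%N = \sum_b C b * c (z + b)%N.
  by apply: IH; have := ltn_ord i; lia.
exists (fun b => - (gamma t)^-1 * \sum_(i < t) gamma i * C i b) => z.
have := rec (y - t + z)%N; rewrite big_ord_recr /=.
have -> : (y - t + z + t = y + z)%N by lia.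
move/eqP; rewrite addrC addr_eq0 => /eqP eq_c.
apply: (mulfI gt0); rewrite eq_c mulr_sumr.
under [RHS]eq_bigr => b _ do rewrite mulrA mulrA mulrN mulfV // mulN1r mulNr mulr_suml.
rewrite sumrN exchange_big; congr (- _); apply: eq_bigr => i _.
have -> : (y - t + z + i = y - t + i + z)%N by lia.
by rewrite cC mulr_sumr; apply: eq_bigr => b _; rewrite mulrA.
Qed.

(** The span of the products of q subsequences of c with common differences
    [x a]; by [shift_expansion] offsets below t suffice, which makes the space
    shift-invariant of dimension at most t^q. *)
Definition prod_span q (x : 'I_q -> nat) (u : nat -> K) :=
  exists kappa : {ffun 'I_q -> 'I_t} -> K,
    forall n, u n = \sum_f kappa f * \prod_a c (x a * n + f a)%N.

Section Fixed.

Variables (q : nat) (x : 'I_q -> nat).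

Lemma prod_spanD u v :
  prod_span x u -> prod_span x v -> prod_span x (fun n => u n + v n).
Proof.
move=> [k uk] [l vl]; exists (fun f => k f + l f) => n.
by rewrite uk vl -big_split; apply: eq_bigr => f _; rewrite mulrDl.
Qed.

Lemma prod_spanZ a u : prod_span x u -> prod_span x (fun n => a * u n).
Proof.
move=> [k uk]; exists (fun f => a * k f) => n.
by rewrite uk mulr_sumr; apply: eq_bigr => f _; rewrite mulrA.
Qed.

Lemma prod_span0 : prod_span x (fun=> 0).
Proof. by exists (fun=> 0) => n; rewrite big1 // => f _; rewrite mul0r. Qed.

Lemma eq_prod_span u v : u =1 v -> prod_span x u -> prod_span x v.
Proof. by move=> uv [k uk]; exists k => n; rewrite -uv. Qed.

Lemma prod_span_sum (I : Type) (r : seq I) (us : I -> nat -> K) :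
  (forall i, prod_span x (us i)) -> prod_span x (fun n => \sum_(i <- r) us i n).
Proof.
move=> Sus; elim: r => [|i r IH].
  by apply: eq_prod_span prod_span0 => n; rewrite big_nil.
by apply: eq_prod_span (prod_spanD (Sus i) IH) => n; rewrite big_cons.
Qed.

Lemma prod_span_prod (y : 'I_q -> nat) :
  prod_span x (fun n => \prod_a c (x a * n + y a)%N).
Proof.
have /fin_all_exists[C cC] a := shift_expansion (y a).
exists (fun f => \prod_a C a (f a)) => n.
under eq_bigr => a _ do rewrite addnC cC.
rewrite bigA_distr_bigA; apply: eq_bigr => f _.
by rewrite -big_split.
Qed.

Lemma prod_span_shift u l : prod_span x u -> prod_span x (fun n => u (n + l)%N).
Proof.
move=> [k uk].
apply: (eq_prod_span (u := fun n => \sum_f k f *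
   \prod_a c (x a * n + (x a * l + f a)))) => [n|].
  rewrite uk; apply: eq_bigr => f _; congr (_ * _); apply: eq_bigr => a _.
  by rewrite addnA mulnDr.
by apply: prod_span_sum => f; apply: prod_spanZ; apply: prod_span_prod.
Qed.

Lemma prod_span_recurrence :
  exists gam, forall u, prod_span x u -> C_recurrence (t ^ q) gam u.
Proof.
have [f|gam rec_g] := @finite_dim_recurrence K {ffun 'I_q -> 'I_t}
    (fun f n => \prod_a c (x a * n + f a)%N).
  have [k uk] := prod_span_shift 1 (prod_span_prod (fun a => f a)).
  by exists k => n; rewrite -uk addn1.
rewrite card_ffun !card_ord in rec_g.
exists (if (t ^ q == 0)%N then fun=> 1 else gam) => u [k uk].
have [tq0 | tq_gt0] := posnP (t ^ q); rewrite ?tq0 /=.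
  have u0 n : u n = 0.
    rewrite uk big1 // => f _.
    have : (0 < #|{ffun 'I_q -> 'I_t}|)%N by apply/card_gt0P; exists f.
    by rewrite card_ffun !card_ord tq0.
  by split=> [|n]; rewrite ?oner_neq0 // big1 // => i _; rewrite u0 mulr0.
split=> [|n].
  have : (0 < #|{ffun 'I_q -> 'I_t}|)%N by rewrite card_ffun !card_ord.
  by case/card_gt0P => f _; case: (rec_g f).
under eq_bigr => i _ do rewrite uk mulr_sumr.
rewrite exchange_big big1 // => f _.
under eq_bigr => i _ do rewrite mulrCA.
by rewrite -mulr_sumr (proj2 (rec_g f)) mulr0.
Qed.

Lemma prod_span_eq0 u : prod_span x u ->
  (forall n, (n < t ^ q)%N -> u n = 0) -> forall n, u n = 0.
Proof.
move=> Su; have [gam rec] := prod_span_recurrence.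
exact: recurrence_zero (rec u Su).
Qed.

Lemma prod_span_det (y : nat -> nat -> nat) :
  prod_span x (fun n => \det (\matrix_(a < q, b < q) c (x a * n + y a b)%N)).
Proof.
apply: prod_span_sum => s; apply: prod_spanZ.
apply: eq_prod_span (prod_span_prod (fun a => y a (s a))) => n.
by apply: eq_bigr => a _; rewrite mxE.
Qed.

End Fixed.

(** By [shift_expansion] the matrix factors through dimension t. *)
Lemma det_window_rank q (y z : nat -> nat) :
  \det (\matrix_(a < q, b < q) c (y a + z b)%N) != 0 -> (q <= t)%N.
Proof.
move=> nz_det.
have /fin_all_exists[C cC] (a : 'I_q) := shift_expansion (y a).
have defA : \matrix_(a < q, b < q) c (y a + z b)%N =
    (\matrix_(a, i) C a i) *m (\matrix_(i < t, b < q) c (z b + i)%N).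
  by apply/matrixP=> a b; rewrite !mxE cC; apply: eq_bigr => i _; rewrite !mxE.
have : (\matrix_(a < q, b < q) c (y a + z b)%N) \in unitmx by rewrite unitmxE unitfE.
rewrite -row_full_unit defA => /eqP <-.
by apply: leq_trans (mxrankM_maxl _ _) (rank_leq_col _).
Qed.

End ProductSpan.

(** * Recurrences between samples at quadratic arguments *)

Section Coefficients.

Variables (K : fieldExtType rat) (c : nat -> K) (t j k e : nat).

(** The distance between the arguments of c in the samples n and n + e i. *)
Definition lag_index i n : nat :=
  ((2 * j * e * i) * n + (j * e ^ 2 * i ^ 2 + k * e * i))%N.

Lemma lag_indexE l i n :
  (j * (n + e * i) ^ 2 + k * (n + e * i) + l =
   lag_index i n + (j * n ^ 2 + k * n + l))%N.
Proof. rewrite /lag_index; ring. Qed.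

Definition window i b n : K := c (lag_index i n + b)%N.

(** The minor of the rows 0, ..., q without row i, in the q columns given by the
    digits of m, with the sign of a cofactor. *)
Definition coefficient q m i n : K :=
  (-1) ^+ i * scaled_det q (fun a b => window (bump i a) (digit t b m) n).

Definition relation q m b n : K :=
  \sum_(0 <= i < q.+1) coefficient q m i n * window i b n.

Lemma charK0 : [pchar K] =i pred0.
Proof. by move=> p; rewrite pchar_lalg pchar_num. Qed.

(** Laplace expansion along the column b that borders the minors. *)
Lemma relationE q m b n : relation q m b n =
  (-1) ^+ q * vandermonde_product K q id * \det (\matrix_(i < q.+1, a < q.+1)
     window i (if (a < q)%N then digit t a m else b) n).
Proof.
rewrite (expand_det_col _ ord_max) mulr_sumr /relation big_mkord.
apply: eq_bigr => i _; rewrite /cofactor /coefficient scaled_detE mxE ltnn /=.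
have -> : \det (row' i (col' ord_max (\matrix_(i0, a) window i0
    (if (a < q)%N then digit t a m else b) n))) =
    \det (\matrix_(a < q, b0 < q) window (bump i a) (digit t b0 m) n).
  congr (\det _); apply/matrixP=> a b0; rewrite !mxE lift_max ltn_ord //.
rewrite exprD; have : (-1) ^+ q * (-1) ^+ q = 1 :> K.
  by rewrite -exprMn mulrNN mulr1 expr1n.
move: ((-1) ^+ q) => s ss; rewrite -[LHS]mul1r -ss; ring.
Qed.

Lemma leading_coefficientE q m n : coefficient q m q n =
  (-1) ^+ q * vandermonde_product K q id *
  \det (\matrix_(a < q, b < q) window a (digit t b m) n).
Proof.
rewrite /coefficient scaled_detE -mulrA; congr (_ * (_ * \det _)).
by apply/matrixP=> a b; rewrite !mxE /bump leqNgt ltn_ord.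
Qed.

Lemma scalar_neq0 q : (-1) ^+ q * vandermonde_product K q id != 0.
Proof.
rewrite mulf_neq0 ?signr_eq0 //.
by apply: vandermonde_product_neq0; apply: charK0.
Qed.

Section Presented.

Variable gamma : nat -> K.
Hypothesis rec_c : C_recurrence t gamma c.

Lemma coefficient_span q m i mu rho :
  prod_span c t (fun a : 'I_q => 2 * j * e * bump i a * mu)%N
    (fun n => coefficient q m i (mu * n + rho)).
Proof.
apply: prod_spanZ.
pose y a b := (2 * j * e * bump i a * rho +
  (j * e ^ 2 * bump i a ^ 2 + k * e * bump i a) + digit t b m)%N.
have span_y := prod_span_det rec_c _ y.
apply: eq_prod_span (prod_spanZ (vandermonde_product K q id) (span_y _ _)) => n.
rewrite scaled_detE; congr (_ * \det _); apply/matrixP=> a b; rewrite !mxE.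
by rewrite /window /lag_index /y; congr c; ring.
Qed.

Lemma coefficient_span1 q m i :
  prod_span c t (fun a : 'I_q => 2 * j * e * bump i a)%N (coefficient q m i).
Proof.
have [kappa ck] := coefficient_span q m i 1 0.
exists kappa => n; have := ck n; rewrite mul1n addn0 => ->.
apply: eq_bigr => f _; congr (_ * _); apply: eq_bigr => a _; by rewrite muln1.
Qed.

Lemma relation_span q m b :
  prod_span c t (fun i : 'I_q.+1 => 2 * j * e * i)%N (relation q m b).
Proof.
pose y i a := (j * e ^ 2 * i ^ 2 + k * e * i +
  if (a < q)%N then digit t a m else b)%N.
pose s := (-1) ^+ q * vandermonde_product K q id.
apply: eq_prod_span (prod_spanZ s (prod_span_det rec_c _ y)) => n.
rewrite relationE; congr (_ * \det _); apply/matrixP=> i a; rewrite !mxE.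
by rewrite /window /lag_index /y; congr c; ring.
Qed.

(** An arbitrary shift by x is a combination of the shifts by b < t. *)
Lemma recurrence_of_relation q m : (forall b n, (b < t)%N -> relation q m b n = 0) ->
  forall x n, \sum_(0 <= i < q.+1) coefficient q m i n * c (lag_index i n + x)%N = 0.
Proof.
move=> rel0 x n; have [C cC] := shift_expansion rec_c x.
under eq_bigr => i _ do rewrite addnC cC mulr_sumr.
rewrite exchange_big big1 // => b _.
under eq_bigr => i _ do rewrite mulrCA.
by rewrite -mulr_sumr -[X in _ * X]/(relation q m b n) rel0 ?mulr0.
Qed.

End Presented.

Lemma leading_order_le r gamma q m n : C_recurrence r gamma c ->
  coefficient q m q n != 0 -> (q <= r)%N.
Proof.
move=> rec_r; rewrite leading_coefficientE mulf_eq0 negb_or => /andP[_].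
have le_qr := @det_window_rank K c r gamma rec_r q
  (lag_index^~ n) (fun b => digit t b m).
exact: le_qr.
Qed.

(** The relations hold because their bordering minors have more rows than the
    largest minor that is not identically zero. *)
Lemma exists_maximal_minor gamma : C_recurrence t gamma c ->
  exists q m, [/\ (m < t ^ q)%N, exists n, coefficient q m q n != 0 &
    forall b n, (b < t)%N -> relation q m b n = 0].
Proof.
move=> rec_c.
pose P q := exists m n, (m < t ^ q)%N /\ coefficient q m q n != 0.
have P0 : P 0.
  exists 0, 0; split=> //; rewrite leading_coefficientE det_mx00 mulr1.
  exact: scalar_neq0.
have leP q : P q -> (q <= t)%N.
  by move=> [m [n [_ nz]]]; apply: leading_order_le rec_c nz.
have [q [Pq nPq]] : exists q, P q /\ ~ P q.+1.
  apply: NNPP => noq.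
  have allP q : P q.
    by elim: q => // q IH; apply: NNPP => nP; apply: noq; exists q.
  by have := leP _ (allP t.+1); rewrite ltnn.
have [m [n [lt_m nz]]] := Pq; exists q, m; split=> //; first by exists n.
move=> b n' lt_b; apply: NNPP => /eqP.
rewrite relationE mulf_eq0 negb_or => /andP[_ nz_det].
apply: nPq.
have [|m' lt_m' m'E] :=
  @digit_onto t q.+1 (fun a => if (a < q)%N then digit t a m else b).
  by move=> a _; case: (ltnP a q) => // lt_a; exact: (ltn_digit lt_m lt_a).
exists m', n'; split=> //; rewrite leading_coefficientE mulf_neq0 ?scalar_neq0 //.
move: nz_det; congr (\det _ != 0); apply/matrixP=> i a; rewrite !mxE.
by rewrite m'E.
Qed.

End Coefficients.

(** * Non-vanishing of the leading coefficient *)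

Section Eigenvalues.

Variables (K : fieldExtType rat) (iota : {rmorphism K -> algC}).
Variables (c : nat -> K) (chi : {poly K}) (lam : seq algC).
Hypothesis char_c : characteristic_poly c chi.
Hypothesis lamP : forall z : algC, (z \in lam) = root (map_poly iota chi) z.
Hypothesis lam0 : forall z : algC, z \in lam -> z != 0.
Hypothesis uniq_lam : uniq lam.

Lemma chi_monic : chi \is monic. Proof. by case: char_c. Qed.

Lemma size_lam : (size lam <= (size chi).-1)%N.
Proof.
have nz : map_poly iota chi != 0 by rewrite map_poly_eq0 monic_neq0 ?chi_monic.
have := max_poly_roots nz; move/(_ lam); rewrite size_map_poly => H.
rewrite -ltnS prednK ?size_poly_gt0 ?monic_neq0 ?chi_monic //.
by apply: H => //; apply/allP => z; rewrite lamP.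
Qed.

Lemma chi_coef0 : chi`_0 != 0.
Proof.
apply/negP=> /eqP chi0.
have : (0 : algC) \in lam by rewrite lamP rootE horner_coef0 coef_map chi0 /= rmorph0.
by move/lam0; rewrite eqxx.
Qed.

Lemma in_mul_group_mem z : z \in lam -> in_mul_group lam z.
Proof.
move=> z_lam; exists (fun i => (i == index z lam)%:Z).
have lt_i : (index z lam < size lam)%N by rewrite index_mem.
rewrite (bigD1 (Ordinal lt_i)) //= eqxx expr1z nth_index // big1 ?mulr1 //.
by move=> i /negPf; rewrite -val_eqE /= => ->.
Qed.

Lemma in_mul_group1 : in_mul_group lam 1.
Proof. by exists (fun=> 0); rewrite big1. Qed.

Lemma lam_nth0 (i : 'I_(size lam)) : lam`_i != 0.
Proof. by apply: lam0; apply: mem_nth. Qed.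

Lemma in_mul_groupM x y :
  in_mul_group lam x -> in_mul_group lam y -> in_mul_group lam (x * y).
Proof.
move=> [a ->] [b ->]; exists (fun i => a i + b i); rewrite -big_split /=.
by apply: eq_bigr => i _; rewrite expfzDr // lam_nth0.
Qed.

Lemma in_mul_groupV x : in_mul_group lam x -> in_mul_group lam x^-1.
Proof.
move=> [a ->]; exists (fun i => - a i); rewrite -prodfV.
by apply: eq_bigr => i _; rewrite invr_expz.
Qed.

Lemma in_mul_group_neq0 x : in_mul_group lam x -> x != 0.
Proof.
by move=> [a ->]; apply/prodf_neq0 => i _; rewrite expfz_neq0 // lam_nth0.
Qed.

Definition power_group D z := exists2 y, in_mul_group lam y & z = y ^+ D.

Lemma power_groupM D x y :
  power_group D x -> power_group D y -> power_group D (x * y).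
Proof.
move=> [x' Gx ->] [y' Gy ->]; exists (x' * y'); last by rewrite exprMn.
exact: in_mul_groupM.
Qed.

Lemma power_group1 D : power_group D 1.
Proof. by exists 1; rewrite ?expr1n //; apply: in_mul_group1. Qed.

Lemma power_group_neq0 D x : power_group D x -> x != 0.
Proof. by move=> [y Gy ->]; rewrite expf_neq0 // in_mul_group_neq0. Qed.

Definition kills_torsion D :=
  forall z n, in_torsion lam z -> n.-primitive_root z -> (n %| D)%N.

(** If x = x'^D and y = y'^D then x' / y' is a root of unity, whose order
    divides D. *)
Lemma power_group_torsion_free D m x y : kills_torsion D -> (0 < D)%N -> (0 < m)%N ->
  power_group D x -> power_group D y -> x ^+ m = y ^+ m -> x = y.
Proof.
move=> killD D_gt0 m_gt0 [x' Gx ->] [y' Gy ->] eq_m.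
have nz_y := in_mul_group_neq0 Gy.
have Dm_gt0 : (0 < D * m)%N by rewrite muln_gt0 D_gt0.
have xy1 : (x' / y') ^+ (D * m) = 1.
  by rewrite expr_div_n !exprM eq_m divff // !expf_neq0.
have Gxy : in_torsion lam (x' / y').
  split; first by apply: in_mul_groupM => //; apply: in_mul_groupV.
  by exists (D * m)%N.
have [n prim_n _] := prim_order_exists Dm_gt0 xy1.
have /dvdnP[h ->] := killD _ _ Gxy prim_n.
have := prim_expr_order prim_n; move/(congr1 (fun z => z ^+ h)).
rewrite expr1n -exprM mulnC expr_div_n => /divr1_eq //.
Qed.

Lemma kills_iota_c : exists2 s, {subset s <= lam} & kills s (iota \o c).
Proof.
have [s defchi] := closed_field_poly_normal (map_poly iota chi).
have lead1 : lead_coef (map_poly iota chi) = 1.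
  by rewrite lead_coef_map (monicP chi_monic) rmorph1.
rewrite lead1 scale1r in defchi.
exists s => [z zs|n]; first by rewrite lamP defchi root_prod_XsubC.
rewrite -defchi /shift_op size_map_poly.
have size_chi : size chi = (size chi).-1.+1.
  by rewrite prednK // size_poly_gt0 monic_neq0 ?chi_monic.
case: char_c => _ _ [_ /(_ n) rec]; rewrite size_chi.
rewrite -[RHS](rmorph0 iota) -rec rmorph_sum; apply: eq_bigr => i _.
by rewrite coef_map rmorphM.
Qed.

(** Expanding the determinant, the bases are products of powers z^(x a) of
    eigenvalues with exponents x a divisible by e mu. *)
Lemma exp_poly_coefficient t j k e q m i mu rho D : (D %| e * mu)%N ->
  exp_poly (power_group D) (fun n => iota (coefficient c t j k e q m i (mu * n + rho))).
Proof.
move=> dvd_D; have [s s_lam kill_s] := kills_iota_c.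
pose x a := (2 * j * e * bump i a * mu)%N.
pose y a b := (2 * j * e * bump i a * rho +
  (j * e ^ 2 * bump i a ^ 2 + k * e * bump i a) + digit t b m)%N.
apply: (eq_exp_poly (u := fun n => iota ((-1) ^+ i * vandermonde_product K q id) *
    \sum_(w : 'S_q) (-1) ^+ w *
      \prod_(a < q) (iota \o c) (x a * n + y a (w a)))) => [n|].
  rewrite /coefficient scaled_detE mulrA [in RHS]rmorphM; congr (_ * _).
  rewrite rmorph_sum; apply: eq_bigr => w _.
  rewrite rmorphM rmorph_sign rmorph_prod; congr (_ * _); apply: eq_bigr => a _.
  by rewrite mxE /window /lag_index /x /y /=; congr (iota (c _)); ring.
apply: exp_polyZ; apply: exp_poly_sum => w; apply: exp_polyZ.
apply: exp_poly_prod => [||a].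
- exact: power_group1.
- exact: power_groupM.
apply: exp_poly_subseq kill_s _ => z /s_lam z_lam.
have /dvdnP[h emuE] := dvd_D.
exists (z ^+ (2 * j * bump i a * h)).
  elim: (_ * h)%N => [|p IH]; first exact: in_mul_group1.
  by rewrite exprS; apply: in_mul_groupM => //; apply: in_mul_group_mem.
rewrite -exprM; congr (_ ^+ _); rewrite /x.
by rewrite -!mulnA -emuE; ring.
Qed.

Lemma nondegenerate_subsequence t j k e q m i mu rho D p r0 :
  kills_torsion D -> (0 < D)%N -> (D %| e * mu)%N -> (0 < p)%N ->
  (forall n, coefficient c t j k e q m i (mu * (p * n + r0) + rho) = 0) ->
  forall n, coefficient c t j k e q m i (mu * n + rho) = 0.
Proof.
move=> killD D_gt0 dvd_D p_gt0 u0 n; apply: (fmorph_inj iota); rewrite rmorph0.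
move: n; have exp_u := exp_poly_coefficient t j k q m i rho dvd_D.
apply: (exp_poly_nondegenerate (m := p) (r := r0) _ _ p_gt0 exp_u).
- exact: power_group_neq0.
- by move=> x y; apply: power_group_torsion_free.
by move=> n; rewrite /= u0 rmorph0.
Qed.

(** The product of the minimal polynomials of the bases over the rationals; its
    constant term is non-zero because the bases are. *)
Lemma rational_annihilator G (u : nat -> K) : (forall z, G z -> z != 0) ->
  exp_poly G (iota \o u) -> exists2 P : {poly rat}, P`_0 != 0 &
    forall n, shift_op (map_poly (in_alg K) P) u n = 0.
Proof.
move=> G0 [s Gs kill_s].
have [P P0 [Q PQ]] : exists2 P : {poly rat}, P`_0 != 0 &
    exists Q, map_poly ratr P = Q * \prod_(z <- s) ('X - z%:P).
  elim: s Gs {kill_s} => [|z s IH] Gs.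
    exists 1; first by rewrite coefC oner_neq0.
    by exists 1; rewrite big_nil mulr1 rmorph1.
  have [|P P0 [Q PQ]] := IH; first by move=> y ys; apply: Gs; rewrite inE ys orbT.
  have nz_z : z != 0 by apply: G0; apply: Gs; apply: mem_head.
  have [p [_ monp] pP] := minCpolyP z.
  have p0 : p`_0 != 0.
    apply/eqP=> p0.
    have /factor_theorem[p' defp] : root p 0 by rewrite rootE horner_coef0 p0.
    rewrite subr0 in defp.
    have nz_p' : p' != 0.
      apply: contraTneq monp => p'0.
      by rewrite defp p'0 mul0r monicE lead_coef0 eq_sym oner_eq0.
    have : root (map_poly ratr p) z by rewrite pP dvdpp.
    rewrite defp rmorphM /= map_polyX rootM rootX (negPf nz_z) orbF pP.
    by move/(dvdp_leq nz_p'); rewrite defp size_mulX // ltnn.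
  have /factor_theorem[S defS] : root (map_poly ratr p) z by rewrite pP dvdpp.
  exists (p * P); first by rewrite coef0M mulf_neq0.
  by exists (S * Q); rewrite big_cons rmorphM /= PQ defS; ring.
exists P => // n; apply: (fmorph_inj iota); rewrite rmorph0.
rewrite -[RHS](dvd_shift_op Q kill_s n) -PQ /shift_op !size_map_poly rmorph_sum.
apply: eq_bigr => i _; rewrite !coef_map rmorphM /=; congr (_ * _).
by rewrite -[LHS]/((iota \o in_alg K) _) fmorph_eq_rat.
Qed.

(** If u vanished infinitely often, it would vanish along a progression of
    difference p by the Skolem-Mahler-Lech theorem.  Restricted to a residue
    class modulo D it is non-degenerate, and it would be zero there. *)
Lemma eventually_nonzero t j k e q m D : kills_torsion D -> (0 < D)%N ->
  (forall rho, (rho < D)%N ->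
     exists n, coefficient c t j k e q m q (D * n + rho) != 0) ->
  exists n1, forall n, (n1 <= n)%N -> coefficient c t j k e q m q n != 0.
Proof.
move=> killD D_gt0 nz; set u := coefficient c t j k e q m q.
have [||P P0 Pu] := @rational_annihilator (power_group 1) u.
- exact: power_group_neq0.
- apply: eq_exp_poly (exp_poly_coefficient t j k q m q 0 (dvd1n (e * 1))) => n.
  by rewrite /= mul1n addn0.
have [p p_gt0 dich] := skolem_mahler_lech_number_field P0 Pu.
have /fin_all_exists[B uB] (r0 : 'I_p) :
    exists B, forall n, (B <= n)%N -> u (r0 + p * n)%N != 0.
  apply: NNPP => noB.
  have u0 : forall n, u (r0 + p * n)%N = 0.
    apply: dich => B; apply: NNPP => noz; apply: noB; exists B => n le_n.
    by apply/negP=> /eqP un; apply: noz; exists n.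
  have [n] := nz (r0 %% D)%N (ltn_pmod _ D_gt0).
  rewrite (nondegenerate_subsequence (D := D) (p := p) (r0 := (r0 %/ D)%N)) ?eqxx //.
    by rewrite dvdn_mull.
  move=> n'; have := u0 (D * n')%N; rewrite {1}(divn_eq r0 D).
  by congr (u _ = 0); ring.
exists (p * (\max_i B i).+1)%N => n le_n.
have lt_r : (n %% p < p)%N by rewrite ltn_pmod.
rewrite (divn_eq n p) addnC mulnC; apply: (uB (Ordinal lt_r)).
rewrite leq_divRL // mulnC; apply: leq_trans le_n; rewrite leq_pmul2l //.
by apply: leqW; apply: (leq_bigmax (Ordinal lt_r)).
Qed.

End Eigenvalues.

(** * Certificates for recurrences *)

Section BoundedQuantifiers.

Lemma big_andP n (F : nat -> bool) :
  reflect (forall i, (i < n)%N -> F i) (\big[andb/true]_(0 <= i < n) F i).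
Proof.
rewrite big_mkord big_andE; apply: (iffP forallP) => H i; last exact: H.
by move=> lt_i; apply: (H (Ordinal lt_i)).
Qed.

Lemma big_orP n (F : nat -> bool) :
  reflect (exists2 i, (i < n)%N & F i) (\big[orb/false]_(0 <= i < n) F i).
Proof.
rewrite big_mkord big_orE; apply: (iffP existsP) => [[i Fi]|[i lt_i Fi]].
  by exists i.
by exists (Ordinal lt_i).
Qed.

End BoundedQuantifiers.

Lemma sum_multiples (V : nmodType) (F : nat -> V) e q : (0 < e)%N ->
  (forall i, (i %% e)%N != 0%N -> F i = 0) ->
  \sum_(0 <= i < (e * q).+1) F i = \sum_(0 <= i < q.+1) F (e * i)%N.
Proof.
move=> e_gt0 F0; elim: q => [|q IH]; first by rewrite muln0 !big_nat1 muln0.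
rewrite [RHS]big_nat_recr //= -IH (@big_cat_nat _ _ _ (e * q).+1) //=; last first.
  by rewrite ltnS leq_mul2l leqnSn orbT.
congr (_ + _); rewrite big_nat_recr /=; last by rewrite ltn_pmul2l.
rewrite big_nat_cond big1 ?add0r // => i /andP[/andP[lt_i i_lt] _].
apply: F0; apply/negP=> /dvdnP[h defi].
have lt_qh : (q < h)%N by rewrite -(ltn_pmul2l e_gt0) [(e * h)%N]mulnC -defi.
have lt_hq : (h < q.+1)%N by rewrite -(ltn_pmul2l e_gt0) [(e * h)%N]mulnC -defi.
by rewrite ltnS leqNgt lt_qh in lt_hq.
Qed.

Section Certificates.

Variables (K : fieldExtType rat) (c : nat -> K) (t j k : nat).

(** At least the order of the relations and of the coefficients, so that
    testing that many terms decides whether they vanish. *)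
Definition order_bound q := (t ^ q + t ^ q.+1)%N.

(** The relations hold, and the leading coefficient is not identically zero on
    any residue class modulo M. *)
Definition lag_test M e q m : bool :=
  (\big[andb/true]_(0 <= n < order_bound q) \big[andb/true]_(0 <= b < t)
     (relation c t j k e q m b n == 0)) &&
  (\big[andb/true]_(0 <= rho < M) \big[orb/false]_(0 <= n < order_bound q)
     (coefficient c t j k e q m q (M * n + rho) != 0)).

Definition good_lag M e : bool :=
  \big[orb/false]_(0 <= q < t.+1) \big[orb/false]_(0 <= m < t ^ q) lag_test M e q m.

(** A recurrence with step e, padded with zero coefficients. *)
Definition stretched e q m i n : K :=
  if (i %% e == 0)%N then coefficient c t j k e q m (i %/ e) n else 0.

Definition presentation_test e q m i (D : seq K * seq K) : bool :=
  [&& size D.1 == (size D.2).+1, D.1`_(size D.2) != 0,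
      D.2 == mkseq (stretched e q m i) (size D.2) &
      \big[andb/true]_(0 <= n < t ^ q)
        (\sum_(0 <= l < (size D.2).+1) D.1`_l * stretched e q m i (n + l) == 0)].

(** The rejection of all smaller steps bounds e by the torsion number, which
    passes [good_lag]. *)
Definition certificate_test M e q m (E : seq (seq K * seq K)) : bool :=
  [&& (0 < e)%N, lag_test M e q m,
      \big[andb/true]_(0 <= e' < e) ((e' == 0)%N || ~~ good_lag M e'),
      size E == (e * q).+1 &
      \big[andb/true]_(0 <= i < (e * q).+1)
        presentation_test e q m i (nth ([::], [::]) E i)].

Variable gamma : nat -> K.
Hypothesis rec_c : C_recurrence t gamma c.

Lemma lag_testP M e q m :
  reflect ((forall b n, (b < t)%N -> relation c t j k e q m b n = 0) /\
           (forall rho, (rho < M)%N ->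
              exists n, coefficient c t j k e q m q (M * n + rho) != 0))
          (lag_test M e q m).
Proof.
apply: (iffP andP) => [[/big_andP rel0 /big_andP nz]|[rel0 nz]]; split.
- move=> b n lt_b.
  apply: (prod_span_eq0 rec_c (relation_span j k e rec_c q m b)) => n' lt_n'.
  have /big_andP/(_ b lt_b)/eqP // := rel0 n' (leq_trans lt_n' (leq_addl _ _)).
- by move=> rho /nz/big_orP[n _ nz_n]; exists n.
- by apply/big_andP => n _; apply/big_andP => b lt_b; rewrite rel0.
apply/big_andP => rho /nz[n]; case: big_orP => // no_n /eqP[].
apply: (prod_span_eq0 rec_c (coefficient_span j k e rec_c q m q M rho)) => n' lt_n'.
apply/eqP/negPn/negP=> nz_n'; apply: no_n; exists n' => //.
exact: leq_trans lt_n' (leq_addr _ _).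
Qed.

Lemma stretched_span e q m i : exists x : 'I_q -> nat,
  prod_span c t x (stretched e q m i).
Proof.
rewrite /stretched; case: eqP => _; last by exists (fun=> 0%N); apply: prod_span0.
exists (fun a : 'I_q => 2 * j * e * bump (i %/ e) a)%N.
by apply: coefficient_span1 rec_c _ _ _.
Qed.

Lemma presentation_test_sound e q m i D :
  presentation_test e q m i D -> presents D (stretched e q m i).
Proof.
case/and4P=> /eqP szD nzD /eqP initD /big_andP recD.
split=> //; split=> // n; have [x span_x] := stretched_span e q m i.
have span_rec : prod_span c t x
    (fun n => \sum_(0 <= l < (size D.2).+1) D.1`_l * stretched e q m i (n + l)).
  by apply: prod_span_sum => l; apply: prod_spanZ; apply: (prod_span_shift rec_c).
rewrite -(big_mkord xpredT (fun l => D.1`_l * stretched e q m i (n + l))).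
by apply: (prod_span_eq0 rec_c span_rec) => n' /recD/eqP.
Qed.

Lemma presentation_exists e q m i : exists D, presentation_test e q m i D.
Proof.
have [x span_x] := stretched_span e q m i.
have [gam rec_span] := prod_span_recurrence rec_c x.
have [nz rec] := rec_span _ span_x.
have [s1 sz1 s1E] : exists2 s1, size s1 = (t ^ q).+1 &
    forall l, (l < (t ^ q).+1)%N -> s1`_l = gam l.
  by exists (mkseq gam (t ^ q).+1) => [|l lt_l]; rewrite ?size_mkseq ?nth_mkseq.
have [s2 s2E sz2] : exists2 s2, s2 = mkseq (stretched e q m i) (t ^ q) &
    size s2 = (t ^ q)%N.
  by exists (mkseq (stretched e q m i) (t ^ q)); rewrite ?size_mkseq.
exists (s1, s2); rewrite /presentation_test /= sz1 sz2 s1E // -s2E !eqxx nz /=.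
apply/big_andP=> n _; rewrite big_mkord; apply/eqP; rewrite -[RHS](rec n).
by apply: eq_bigr => l _; rewrite s1E.
Qed.

Lemma certificate_exists M : (exists2 e, (0 < e)%N & good_lag M e) ->
  exists e q m E, certificate_test M e q m E.
Proof.
move=> [e0 e0_gt0 good_e0].
have exP : exists e, (0 < e)%N && good_lag M e by exists e0; rewrite e0_gt0.
have [e /andP[e_gt0 /big_orP[q _ /big_orP[m _ test_e]]] min_e] := ex_minnP exP.
have /fin_all_exists[E testE] (i : 'I_(e * q).+1) := presentation_exists e q m i.
exists e, q, m, (mkseq (fun i => E (inord i)) (e * q).+1).
rewrite /certificate_test e_gt0 test_e size_mkseq eqxx /=; apply/andP; split.
  apply/big_andP=> e' lt_e'; rewrite orbC -implybE; apply/implyP=> good_e'.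
  rewrite eqn0Ngt; apply/negP=> e'_gt0; have := min_e e'.
  by rewrite e'_gt0 good_e' leqNgt lt_e' => /(_ isT).
apply/big_andP=> i lt_i; rewrite nth_mkseq //.
by have := testE (inord i); rewrite inordK.
Qed.

Lemma stretched_recurrence e q m l n : (0 < e)%N ->
  (forall b n, (b < t)%N -> relation c t j k e q m b n = 0) ->
  \sum_(i < (e * q).+1) stretched e q m i n *
     c (j * (n + i) ^ 2 + k * (n + i) + l)%N = 0.
Proof.
move=> e_gt0 rel0.
rewrite -[RHS](recurrence_of_relation rec_c rel0 (j * n ^ 2 + k * n + l) n).
pose F i := stretched e q m i n * c (j * (n + i) ^ 2 + k * (n + i) + l)%N.
rewrite -(big_mkord xpredT F).
have term i : F (e * i)%N = coefficient c t j k e q m i n *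
    c (lag_index j k e i n + (j * n ^ 2 + k * n + l))%N.
  by rewrite /F /stretched modnMr eqxx mulKn // lag_indexE.
under [RHS]eq_bigr => i _ do rewrite -term.
apply: sum_multiples => // i /negPf nz_i.
by rewrite /F /stretched nz_i mul0r.
Qed.

End Certificates.

(** * Recursive functions on codes of lists *)

Section Recursive.

Local Open Scope nat_scope.

(** The arity matters because projections are undefined on short lists. *)
Definition recursive n (f : seq nat -> nat) : Prop :=
  exists P, forall v, size v = n -> recfun_eval P v (f v).

Lemma eq_recursive n f g : (forall v, size v = n -> f v = g v) ->
  recursive n f -> recursive n g.
Proof. by move=> fg [P Pf]; exists P => v vn; rewrite -fg //; apply: Pf. Qed.

Lemma recursive_proj n i : i < n -> recursive n (fun v => nth 0 v i).
Proof. by move=> lt_in; exists (Proj i) => v vn; apply: eval_proj; rewrite vn. Qed.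

Lemma recursive_comp1 n f g :
  recursive 1 f -> recursive n g -> recursive n (fun v => f [:: g v]).
Proof.
move=> [P Pf] [Q Qg]; exists (Comp P [:: Q]) => v vn.
apply: (eval_comp (ys := [:: g v])); last exact: Pf.
by apply: evals_cons; [apply: Qg | apply: evals_nil].
Qed.

Lemma recursive_comp2 n f g h : recursive 2 f -> recursive n g -> recursive n h ->
  recursive n (fun v => f [:: g v; h v]).
Proof.
move=> [P Pf] [Q Qg] [S Sh]; exists (Comp P [:: Q; S]) => v vn.
apply: (eval_comp (ys := [:: g v; h v])); last exact: Pf.
by do 2?[apply: evals_cons; [by auto|]]; apply: evals_nil.
Qed.

Lemma recursive0 n : recursive n (fun=> 0).
Proof. by exists Zero => v _; apply: eval_zero. Qed.

Lemma recursive_succ n g : recursive n g -> recursive n (fun v => (g v).+1).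
Proof.
move=> rg; apply: (recursive_comp1 (f := fun v => (head 0 v).+1)) => //.
by exists Succ => [[|x []]] // _; apply: eval_succ.
Qed.

Lemma recursive_const n a : recursive n (fun=> a).
Proof. by elim: a => [|a IH]; [apply: recursive0 | apply: recursive_succ]. Qed.

Lemma recursive_primrec n f g : recursive n f -> recursive n.+2 g ->
  recursive n.+1 (fun v =>
    nat_rect (fun=> nat) (f (behead v)) (fun i z => g [:: i, z & behead v])
             (head 0 v)).
Proof.
move=> [P Pf] [Q Qg]; exists (PrimRec P Q) => [[|x v]] //= [vn].
elim: x => [|x IH] /=; first by apply/eval_primrec0/Pf.
by apply: eval_primrecS IH _; apply: Qg; rewrite /= vn.
Qed.

Lemma recursive_mu n f h : recursive n.+1 f ->
  (forall v, size v = n -> f (h v :: v) = 0) ->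
  (forall v i, size v = n -> i < h v -> 0 < f (i :: v)) -> recursive n h.
Proof.
move=> [P Pf] f0 f_gt0; exists (Mu P) => v vn.
apply: (eval_mu (z := fun i => (f (i :: v)).-1)) => [i lt_i|].
  by rewrite prednK ?f_gt0 //; apply: Pf; rewrite /= vn.
by rewrite -(f0 v vn); apply: Pf; rewrite /= vn.
Qed.

Lemma recursive_add : recursive 2 (fun v => nth 0 v 0 + nth 0 v 1).
Proof.
have := recursive_primrec (recursive_proj (isT : 0 < 1))
  (recursive_succ (recursive_proj (isT : 1 < 3))).
apply: eq_recursive => [[|x [|y []]]] //= _.
by elim: x => //= x ->.
Qed.

Lemma recursive_iszero : recursive 1 (fun v => nth 0 v 0 == 0).
Proof.
have := recursive_primrec (recursive_const 0 1) (recursive_const 2 0).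
by apply: eq_recursive => [[|[|x] []]].
Qed.

Lemma recursive_odd : recursive 1 (fun v => odd (nth 0 v 0)).
Proof.
have := recursive_primrec (recursive_const 0 0)
  (recursive_comp1 recursive_iszero (recursive_proj (isT : 1 < 2))).
apply: eq_recursive => [[|x []]] //= _.
by elim: x => //= x ->; case: (odd x).
Qed.

Lemma recursive_half : recursive 1 (fun v => (nth 0 v 0)./2).
Proof.
have := recursive_primrec (recursive_const 0 0)
  (recursive_comp2 recursive_add
    (recursive_comp1 recursive_odd (recursive_proj (isT : 0 < 2)))
    (recursive_proj (isT : 1 < 2))).
apply: eq_recursive => [[|x []]] //= _.
by elim: x => //= x ->; rewrite uphalf_half.
Qed.

Lemma recursive_shift : recursive 2 (fun v => iter (nth 0 v 0) half (nth 0 v 1)).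
Proof.
have := recursive_primrec (recursive_proj (isT : 0 < 1))
  (recursive_comp1 recursive_half (recursive_proj (isT : 1 < 3))).
by apply: eq_recursive => [[|x [|y []]]].
Qed.

Definition code_head n := head 0 (CodeSeq.decode n).
Definition code_tail n := CodeSeq.code (behead (CodeSeq.decode n)).
Definition code_cons x n := 2 ^ x * n.*2.+1.

Lemma iter_half_code_cons x n i : i <= x ->
  iter i half (code_cons x n) = code_cons (x - i) n.
Proof.
elim: i => [|i IH] lt_ix; first by rewrite subn0.
rewrite /= IH ?(ltnW lt_ix) //; have -> : x - i = (x - i.+1).+1 by lia.
by rewrite /code_cons expnS -mulnA mul2n doubleK.
Qed.

Variant code_spec : nat -> nat -> nat -> Type :=
  | CodeNil : code_spec 0 0 0
  | CodeCons x n : code_spec (code_cons x n) x n.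

Lemma codeP n : code_spec n (code_head n) (code_tail n).
Proof.
rewrite /code_head /code_tail; rewrite -{1}[n]CodeSeq.decodeK.
case: (CodeSeq.decode n) => [|x s] /=; first exact: CodeNil.
exact: CodeCons.
Qed.

Lemma code_cons_gt0 x n : 0 < code_cons x n.
Proof. by rewrite muln_gt0 expn_gt0. Qed.

(** The head of a list is the number of times that its code can be halved before
    it becomes odd; the search stops at once on the code 0 of the empty list. *)
Lemma recursive_code_head : recursive 1 (fun v => code_head (nth 0 v 0)).
Proof.
have test := recursive_comp1 recursive_iszero
  (recursive_comp2 recursive_add
    (recursive_comp1 recursive_iszero (recursive_proj (isT : 1 < 2)))
    (recursive_comp1 recursive_odd
      (recursive_comp2 recursive_shift (recursive_proj (isT : 0 < 2))
        (recursive_proj (isT : 1 < 2))))).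
apply: recursive_mu test _ _ => [[|n []]|[|n []] i] //= _.
  case: codeP => //= x {}n; rewrite iter_half_code_cons // subnn.
  by rewrite /code_cons mul1n /= odd_double addn1.
case: codeP => //= x {}n lt_ix; rewrite iter_half_code_cons ?(ltnW lt_ix) //.
rewrite (gtn_eqF (code_cons_gt0 x n)).
have -> : x - i = (x - i).-1.+1 by lia.
by rewrite /code_cons expnS -mulnA mul2n odd_double.
Qed.

Lemma recursive_code_tail : recursive 1 (fun v => code_tail (nth 0 v 0)).
Proof.
have := recursive_comp1 recursive_half
  (recursive_comp2 recursive_shift recursive_code_head
    (recursive_proj (isT : 0 < 1))).
apply: eq_recursive => [[|n []]] //= _.
case: codeP => //= x {}n; rewrite iter_half_code_cons // subnn.
by rewrite /code_cons mul1n /= uphalf_double.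
Qed.

Lemma recursive_code_cons : recursive 2 (fun v => code_cons (nth 0 v 0) (nth 0 v 1)).
Proof.
have dbl m i : i < m -> recursive m (fun v => nth 0 v i + nth 0 v i).
  by move=> lt_im; apply: recursive_comp2 recursive_add _ _; apply: recursive_proj.
have := recursive_primrec (recursive_succ (dbl 1 0 isT)) (dbl 3 1 isT).
apply: eq_recursive => [[|x [|n []]]] //= _.
rewrite /code_cons; elim: x => [|x /= ->]; first by rewrite mul1n /= addnn.
by rewrite expnS -mulnA mul2n addnn.
Qed.

End Recursive.

(** * Computable functions between encoded types *)

(** A type with a coding by natural numbers, through which algorithms see its
    elements; computability only looks at the codes of arguments and values. *)
Class encoding (X : Type) := enc : X -> nat.

#[global] Instance enc_nat : encoding nat := id.
#[global] Instance enc_bool : encoding bool := nat_of_bool.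
#[global] Instance enc_prod X Y (EX : encoding X) (EY : encoding Y) :
  encoding (X * Y) := fun p => CodeSeq.code [:: enc p.1; enc p.2].
#[global] Instance enc_seq X (EX : encoding X) : encoding (seq X) :=
  fun s => CodeSeq.code (map enc s).

Definition computable {X Y} {EX : encoding X} {EY : encoding Y} (f : X -> Y) :=
  exists P, forall x, recfun_eval P [:: enc x] (enc (f x)).

Local Open Scope nat_scope.

Section Closure.

Context {X Y Z : Type} {EX : encoding X} {EY : encoding Y} {EZ : encoding Z}.

Lemma eq_computable (f g : X -> Y) : f =1 g -> computable f -> computable g.
Proof. by move=> fg [P Pf]; exists P => x; rewrite -fg. Qed.

(** Functions with equal codes of values are the same to an algorithm. *)
Lemma computable_recode (f : X -> Y) (g : X -> Z) :
  (forall x, enc (g x) = enc (f x)) -> computable g -> computable f.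
Proof. by move=> gf [P Pg]; exists P => x; rewrite -gf. Qed.

Lemma computable_recursive1 h (f : X -> nat) :
  recursive 1 h -> computable f -> computable (fun x => h [:: f x]).
Proof.
move=> [P Ph] [Q Qf]; exists (Comp P [:: Q]) => x.
apply: (eval_comp (ys := [:: f x])); last exact: Ph.
by apply: evals_cons; [apply: Qf | apply: evals_nil].
Qed.

Lemma computable_recursive2 h (f g : X -> nat) : recursive 2 h ->
  computable f -> computable g -> computable (fun x => h [:: f x; g x]).
Proof.
move=> [P Ph] [Q Qf] [R Rg]; exists (Comp P [:: Q; R]) => x.
apply: (eval_comp (ys := [:: f x; g x])); last exact: Ph.
apply: evals_cons; first exact: Qf.
by apply: evals_cons; [apply: Rg | apply: evals_nil].
Qed.

Lemma computable_id : computable (fun x : X => x).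
Proof. by exists (Proj 0) => x; apply: eval_proj. Qed.

Lemma computable_const (y : Y) : computable (fun _ : X => y).
Proof.
by have [P Py] := recursive_const 1 (enc y); exists P => x; apply: (Py [:: enc x]).
Qed.

Lemma computable_comp (f : Y -> Z) (g : X -> Y) :
  computable f -> computable g -> computable (fun x => f (g x)).
Proof.
move=> [P Pf] [Q Qg]; exists (Comp P [:: Q]) => x.
apply: (eval_comp (ys := [:: enc (g x)])); last exact: Pf.
by apply: evals_cons; [apply: Qg | apply: evals_nil].
Qed.

End Closure.

Section CodedData.

Context {X Y Z : Type} {EX : encoding X} {EY : encoding Y} {EZ : encoding Z}.

Lemma computable_enc (f : X -> Y) : computable f -> computable (fun x => enc (f x)).
Proof. exact: (computable_recode (g := f)). Qed.

Lemma computable_code_head (f : X -> nat) :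
  computable f -> computable (fun x => code_head (f x)).
Proof. exact: computable_recursive1 recursive_code_head. Qed.

Lemma computable_code_tail (f : X -> nat) :
  computable f -> computable (fun x => code_tail (f x)).
Proof. exact: computable_recursive1 recursive_code_tail. Qed.

Lemma computable_code_cons (f g : X -> nat) :
  computable f -> computable g -> computable (fun x => code_cons (f x) (g x)).
Proof. exact: computable_recursive2 recursive_code_cons. Qed.

Lemma code_head_cons a s : code_head (CodeSeq.code (a :: s)) = a.
Proof. by rewrite /code_head CodeSeq.codeK. Qed.

Lemma code_tail_cons a s : code_tail (CodeSeq.code (a :: s)) = CodeSeq.code s.
Proof. by rewrite /code_tail CodeSeq.codeK. Qed.

End CodedData.

Section Pairs.

Context {X Y Z : Type} {EX : encoding X} {EY : encoding Y} {EZ : encoding Z}.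

Lemma computable_pair (f : X -> Y) (g : X -> Z) :
  computable f -> computable g -> computable (fun x => (f x, g x)).
Proof.
move=> cf cg.
apply: (computable_recode (g := fun x =>
  code_cons (enc (f x)) (code_cons (enc (g x)) 0))) => //.
apply: computable_code_cons; first exact: computable_enc.
by apply: computable_code_cons; [apply: computable_enc | apply: computable_const].
Qed.

Lemma computable_fst (f : X -> Y * Z) :
  computable f -> computable (fun x => (f x).1).
Proof.
move=> cf; apply: (computable_recode (g := fun x => code_head (enc (f x)))).
  by move=> x; rewrite [LHS]code_head_cons.
exact/computable_code_head/computable_enc.
Qed.

Lemma computable_snd (f : X -> Y * Z) :
  computable f -> computable (fun x => (f x).2).
Proof.
move=> cf.
apply: (computable_recode (g := fun x => code_head (code_tail (enc (f x))))).
  move=> x; have -> : enc (f x) = CodeSeq.code [:: enc (f x).1; enc (f x).2] by [].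
  by rewrite code_tail_cons [LHS]code_head_cons.
exact/computable_code_head/computable_code_tail/computable_enc.
Qed.

End Pairs.

Section Recursion.

Context {X Y Z : Type} {EX : encoding X} {EY : encoding Y} {EZ : encoding Z}.

Lemma computable_natrec (n : X -> nat) (g : X -> Y) (h : X -> nat -> Y -> Y) :
  computable n -> computable g ->
  computable (fun p : X * (nat * Y) => h p.1 p.2.1 p.2.2) ->
  computable (fun x => nat_rect (fun=> Y) (g x) (h x) (n x)).
Proof.
move=> [N Nn] [P Pg] [Q Qh].
have pr i : i < 3 -> recursive 3 (fun v => nth 0 v i) by apply: recursive_proj.
have [S Spack] := recursive_comp2 recursive_code_cons (pr 2 isT)
  (recursive_comp2 recursive_code_cons (recursive_comp2 recursive_code_cons
    (pr 0 isT) (recursive_comp2 recursive_code_cons (pr 1 isT) (recursive0 3)))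
  (recursive0 3)).
have [I In] := @computable_id X _.
exists (Comp (PrimRec P (Comp Q [:: S])) [:: N; I]) => x.
apply: (eval_comp (ys := [:: n x; enc x])).
  apply: evals_cons; first exact: Nn.
  by apply: evals_cons; [apply: In | apply: evals_nil].
elim: (n x) => [|m IH] /=; first exact/eval_primrec0/Pg.
apply: eval_primrecS IH _.
set y := nat_rect _ _ _ _.
apply: (eval_comp (ys := [:: enc (x, (m, y))])); last exact: Qh.
by apply: evals_cons; [apply: Spack | apply: evals_nil].
Qed.

(** The search may diverge at arguments x without a solution. *)
Lemma computable_partial_mu (F : X -> nat -> bool) :
  computable (fun p : X * nat => F p.1 p.2) ->
  exists P, forall x n, F x n -> (forall i, i < n -> ~~ F x i) ->
    recfun_eval P [:: enc x] n.
Proof.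
move=> [Q QF].
have pr i : i < 2 -> recursive 2 (fun v => nth 0 v i) by apply: recursive_proj.
have [S Spack] := recursive_comp2 recursive_code_cons (pr 1 isT)
  (recursive_comp2 recursive_code_cons (pr 0 isT) (recursive0 2)).
have [Z' Zero'] := recursive_iszero.
exists (Mu (Comp Z' [:: Comp Q [:: S]])) => x n Fn Flt.
have ev i : recfun_eval (Comp Z' [:: Comp Q [:: S]]) [:: i; enc x] (~~ F x i).
  have -> : ~~ F x i = (nth 0 [:: nat_of_bool (F x i)] 0 == 0) :> nat by case: (F x i).
  apply: (eval_comp (ys := [:: enc (F x i)])); last exact: Zero'.
  apply: evals_cons; last exact: evals_nil.
  apply: (eval_comp (ys := [:: enc (x, i)])); last exact: (QF (x, i)).
  by apply: evals_cons; [apply: Spack | apply: evals_nil].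
apply: (eval_mu (z := fun=> 0)) => [i lt_in|].
  by have := ev i; rewrite Flt.
by have := ev n; rewrite Fn.
Qed.

Lemma computable_mu (F : X -> nat -> bool) (m : X -> nat) :
  computable (fun p : X * nat => F p.1 p.2) ->
  (forall x, F x (m x)) -> (forall x i, i < m x -> ~~ F x i) -> computable m.
Proof.
by move=> /computable_partial_mu[P mu] Fm Flt; exists P => x; apply: mu; auto.
Qed.

End Recursion.

Section Conditional.

Context {X Y Z W : Type} {EX : encoding X} {EY : encoding Y} {EZ : encoding Z}
  {EW : encoding W}.

Lemma computable_if (b : X -> bool) (f g : X -> Y) :
  computable b -> computable f -> computable g ->
  computable (fun x => if b x then f x else g x).
Proof.
move=> cb cf cg.
have: computable (fun x => nat_rect (fun=> Y) (g x) (fun _ _ => f x) (enc (b x))).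
  apply: computable_natrec => //.
  exact: (computable_comp cf (computable_fst (@computable_id _ _))).
by apply: eq_computable => x; case: (b x).
Qed.

Lemma computable_app2 (F : Y -> Z -> W) (f : X -> Y) (g : X -> Z) :
  computable (fun p : Y * Z => F p.1 p.2) -> computable f -> computable g ->
  computable (fun x => F (f x) (g x)).
Proof.
move=> cF cf cg; apply: (computable_comp cF (g := fun x => (f x, g x))).
exact: computable_pair.
Qed.

End Conditional.

Create HintDb computability discriminated.

(** Proves that an expression built from computable functions is computable.
    Projections, pairs and conditionals are recognised syntactically, because
    unification up to conversion would turn a projection into an unbounded
    tower of projections.  Every other operation is dispatched on its head
    symbol by the hint database, which each operation below extends. *)
Ltac computability :=
  cbv beta;
  lazymatch goal with
  | |- computable fst => exact: (computable_fst computable_id)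
  | |- computable snd => exact: (computable_snd computable_id)
  | |- computable (fun x => fst (@?f x)) =>
    refine (computable_fst (f := f) _); computability
  | |- computable (fun x => snd (@?f x)) =>
    refine (computable_snd (f := f) _); computability
  | |- computable (fun x => (@?f x, @?g x)) =>
    refine (computable_pair (f := f) (g := g) _ _); computability
  | |- computable (fun x => if _ then _ else _) =>
    apply: computable_if; computability
  | |- computable _ =>
    first
    [ assumption
    | exact: computable_const
    | exact: computable_id
    | match goal with
      | H : computable ?f |- computable (fun x => ?f (@?g x)) =>
        refine (computable_comp (g := g) H _); computability
      end
    | match goal with
      | H : computable (fun p => ?F (fst p) (snd p))
        |- computable (fun x => ?F (@?f x) (@?g x)) =>
        refine (computable_app2 (f := f) (g := g) H _ _); computability
      end
    | solve [auto 1 with computability nocore]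
    | match goal with
      | H : computable (fun x => _) |- _ =>
        solve [apply: (computable_comp H); computability]
      end ]
  end.

#[global] Hint Extern 0 (computable (fun x => enc _)) =>
  apply: computable_enc; computability : computability.

Lemma computable_succ X (EX : encoding X) (f : X -> nat) :
  computable f -> computable (fun x => (f x).+1).
Proof.
move=> cf.
exact: (computable_recursive1 (recursive_succ (recursive_proj (isT : 0 < 1))) cf).
Qed.

#[global] Hint Extern 0 (computable (fun x => S _)) =>
  apply: computable_succ; computability : computability.

Lemma computable_add X (EX : encoding X) (f g : X -> nat) :
  computable f -> computable g -> computable (fun x => f x + g x).
Proof. exact: computable_recursive2 recursive_add. Qed.

#[global] Hint Extern 0 (computable (fun x => addn _ _)) =>
  apply: computable_add; computability : computability.

Lemma computable_eq0 X (EX : encoding X) (f : X -> nat) :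
  computable f -> computable (fun x => f x == 0).
Proof.
move=> cf; apply: (computable_recode (g := fun x => nat_of_bool (f x == 0))) => //.
exact: computable_recursive1 recursive_iszero cf.
Qed.

Lemma computable_pred X (EX : encoding X) (f : X -> nat) :
  computable f -> computable (fun x => (f x).-1).
Proof.
move=> cf.
have: computable (fun x => nat_rect (fun=> nat) 0 (fun i _ => i) (f x)).
  by apply: computable_natrec; computability.
by apply: eq_computable => x; case: (f x).
Qed.

#[global] Hint Extern 0 (computable (fun x => predn _)) =>
  apply: computable_pred; computability : computability.

Lemma computable_mul X (EX : encoding X) (f g : X -> nat) :
  computable f -> computable g -> computable (fun x => f x * g x).
Proof.
move=> cf cg.
have: computable (fun x => nat_rect (fun=> nat) 0 (fun _ y => g x + y) (f x)).
  by apply: computable_natrec; computability.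
by apply: eq_computable => x; elim: (f x) => //= n ->.
Qed.

#[global] Hint Extern 0 (computable (fun x => muln _ _)) =>
  apply: computable_mul; computability : computability.

Lemma computable_sub X (EX : encoding X) (f g : X -> nat) :
  computable f -> computable g -> computable (fun x => f x - g x).
Proof.
move=> cf cg.
have: computable (fun x => nat_rect (fun=> nat) (f x) (fun _ y => y.-1) (g x)).
  by apply: computable_natrec; computability.
by apply: eq_computable => x; elim: (g x) => [|n /= ->]; rewrite ?subn0 ?subnS.
Qed.

#[global] Hint Extern 0 (computable (fun x => subn _ _)) =>
  apply: computable_sub; computability : computability.

Lemma computable_exp X (EX : encoding X) (f g : X -> nat) :
  computable f -> computable g -> computable (fun x => f x ^ g x).
Proof.
move=> cf cg.
have: computable (fun x => nat_rect (fun=> nat) 1 (fun _ y => f x * y) (g x)).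
  by apply: computable_natrec; computability.
by apply: eq_computable => x; elim: (g x) => [|n /= ->]; rewrite ?expnS.
Qed.

#[global] Hint Extern 0 (computable (fun x => expn _ _)) =>
  apply: computable_exp; computability : computability.

Lemma computable_fact X (EX : encoding X) (f : X -> nat) :
  computable f -> computable (fun x => (f x)`!).
Proof.
move=> cf.
have: computable (fun x => nat_rect (fun=> nat) 1 (fun i y => i.+1 * y) (f x)).
  by apply: computable_natrec; computability.
by apply: eq_computable => x; elim: (f x) => //= n ->.
Qed.

#[global] Hint Extern 0 (computable (fun x => factorial _)) =>
  apply: computable_fact; computability : computability.

Lemma computable_negb X (EX : encoding X) (b : X -> bool) :
  computable b -> computable (fun x => ~~ b x).
Proof.
move=> cb.
have: computable (fun x => if b x then false else true) by computability.
by apply: eq_computable => x; case: (b x).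
Qed.

#[global] Hint Extern 0 (computable (fun x => negb _)) =>
  apply: computable_negb; computability : computability.

Lemma computable_andb X (EX : encoding X) (b c : X -> bool) :
  computable b -> computable c -> computable (fun x => b x && c x).
Proof.
move=> cb cc.
have: computable (fun x => if b x then c x else false) by computability.
by apply: eq_computable => x; case: (b x).
Qed.

#[global] Hint Extern 0 (computable (fun x => andb _ _)) =>
  apply: computable_andb; computability : computability.

Lemma computable_orb X (EX : encoding X) (b c : X -> bool) :
  computable b -> computable c -> computable (fun x => b x || c x).
Proof.
move=> cb cc.
have: computable (fun x => if b x then true else c x) by computability.
by apply: eq_computable => x; case: (b x).
Qed.

#[global] Hint Extern 0 (computable (fun x => orb _ _)) =>
  apply: computable_orb; computability : computability.

Lemma computable_leq X (EX : encoding X) (f g : X -> nat) :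
  computable f -> computable g -> computable (fun x => f x <= g x).
Proof. by move=> cf cg; apply/computable_eq0/computable_sub. Qed.

#[global] Hint Extern 0 (computable (fun x => leq _ _)) =>
  apply: computable_leq; computability : computability.

Lemma computable_eqn X (EX : encoding X) (f g : X -> nat) :
  computable f -> computable g -> computable (fun x => f x == g x).
Proof.
move=> cf cg; have: computable (fun x => (f x <= g x) && (g x <= f x)).
  by computability.
by apply: eq_computable => x; rewrite eqn_leq.
Qed.

#[global] Hint Extern 0 (computable (fun x => eq_op _ _)) =>
  apply: computable_eqn; computability : computability.

Lemma computable_eq X (EX : encoding X) (Y : eqType) (EY : encoding Y)
    (f g : X -> Y) : injective (enc : Y -> nat) ->
  computable f -> computable g -> computable (fun x => f x == g x).
Proof.
move=> inj cf cg; have := computable_eqn (computable_enc cf) (computable_enc cg).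
by apply: eq_computable => x; rewrite inj_eq.
Qed.

Lemma computable_div X (EX : encoding X) (f g : X -> nat) :
  computable f -> computable g -> computable (fun x => f x %/ g x).
Proof.
move=> cf cg.
apply: (computable_mu (F := fun x q => (g x == 0) || (f x < q.+1 * g x)))
  => [|x|x i].
- by computability.
- by case: eqP => //= /eqP; rewrite -lt0n => gt0; rewrite ltn_ceil.
case: eqP => [->|/eqP]; rewrite ?divn0 // -lt0n => gt0.
by rewrite leq_divRL //= -leqNgt.
Qed.

#[global] Hint Extern 0 (computable (fun x => divn _ _)) =>
  apply: computable_div; computability : computability.

Lemma computable_mod X (EX : encoding X) (f g : X -> nat) :
  computable f -> computable g -> computable (fun x => f x %% g x).
Proof.
move=> cf cg; have: computable (fun x => f x - f x %/ g x * g x) by computability.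
by apply: eq_computable => x; rewrite {1}(divn_eq (f x) (g x)) addKn.
Qed.

#[global] Hint Extern 0 (computable (fun x => modn _ _)) =>
  apply: computable_mod; computability : computability.

Lemma code_tail_drop (s : seq nat) i :
  iter i code_tail (CodeSeq.code s) = CodeSeq.code (drop i s).
Proof.
elim: i s => [|i IH] s; first by rewrite drop0.
rewrite iterSr; case: s => [|x s]; last by rewrite code_tail_cons IH.
by rewrite /code_tail -[X in iter i _ X]/(CodeSeq.code [::]) IH.
Qed.

Lemma code_eq0 s : (CodeSeq.code s == 0) = nilp s.
Proof. by case: s => //= a s; rewrite eqn0Ngt muln_gt0 expn_gt0. Qed.

Lemma computable_code_drop X (EX : encoding X) (i n : X -> nat) :
  computable i -> computable n ->
  computable (fun x => iter (i x) code_tail (n x)).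
Proof.
move=> ci cn.
have: computable (fun x => nat_rect (fun=> nat) (n x) (fun _ => code_tail) (i x)).
  apply: computable_natrec => //.
  by apply: computable_code_tail; computability.
by apply: eq_computable => x; elim: (i x) => //= m ->.
Qed.

Lemma computable_size X (EX : encoding X) A (EA : encoding A) (s : X -> seq A) :
  computable s -> computable (fun x => size (s x)).
Proof.
move=> cs.
have drop0E x i : (iter i code_tail (enc (s x)) == 0) = (size (s x) <= i).
  by rewrite code_tail_drop code_eq0 /nilp size_drop size_map subn_eq0.
apply: (computable_mu (F := fun x i => iter i code_tail (enc (s x)) == 0))
  => [|x|x i].
- by apply: computable_eq0; apply: computable_code_drop; computability.
- by rewrite drop0E.
by rewrite drop0E -ltnNge.
Qed.

#[global] Hint Extern 0 (computable (fun x => size _)) =>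
  apply: computable_size; computability : computability.

Lemma computable_nth X (EX : encoding X) A (EA : encoding A) a
    (s : X -> seq A) i :
  computable s -> computable i -> computable (fun x => nth a (s x) (i x)).
Proof.
move=> cs ci.
apply: (computable_recode (g := fun x => if i x < size (s x)
  then code_head (iter (i x) code_tail (enc (s x))) else enc a)) => [x|].
  case: ltnP => [lt_i|le_i]; last by rewrite nth_default.
  rewrite code_tail_drop (drop_nth 0) ?size_map // [LHS]code_head_cons.
  by rewrite (nth_map a).
apply: computable_if; [by computability | | by computability].
by apply: computable_code_head; apply: computable_code_drop; computability.
Qed.

#[global] Hint Extern 0 (computable (fun x => nth _ _ _)) =>
  apply: computable_nth; computability : computability.

Lemma computable_cons X (EX : encoding X) A (EA : encoding A)
    (f : X -> A) (s : X -> seq A) :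
  computable f -> computable s -> computable (fun x => f x :: s x).
Proof.
move=> cf cs.
apply: (computable_recode
  (g := fun x => code_cons (enc (f x)) (enc (s x)))) => //.
by apply: computable_code_cons; computability.
Qed.

#[global] Hint Extern 0 (computable (fun x => cons _ _)) =>
  apply: computable_cons; computability : computability.

Lemma computable_mkseq X (EX : encoding X) A (EA : encoding A)
    (F : X -> nat -> A) n :
  computable (fun p : X * nat => F p.1 p.2) -> computable n ->
  computable (fun x => mkseq (F x) (n x)).
Proof.
move=> cF cn.
(* Consing builds a list from its last entry backwards. *)
have: computable (fun x => nat_rect (fun=> seq A) [::]
    (fun i s => F x (n x - i.+1) :: s) (n x)).
  by apply: computable_natrec; computability.
apply: eq_computable => x.
suff E m : m <= n x ->
    nat_rect (fun=> seq A) [::] (fun i s => F x (n x - i.+1) :: s) m =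
    map (F x) (iota (n x - m) m) by rewrite E // subnn.
elim: m => //= m IH lt_mn; rewrite IH 1?ltnW //.
by have -> : n x - m = (n x - m.+1).+1 by lia.
Qed.

#[global] Hint Extern 0 (computable (fun x => mkseq _ _)) =>
  apply: computable_mkseq; computability : computability.

Lemma computable_big X (EX : encoding X) B (EB : encoding B) (idx : B)
    (op : Monoid.law idx) (F : X -> nat -> B) n :
  computable (fun p : B * B => op p.1 p.2) ->
  computable (fun p : X * nat => F p.1 p.2) -> computable n ->
  computable (fun x => \big[op/idx]_(0 <= i < n x) F x i).
Proof.
move=> cop cF cn.
have: computable (fun x => nat_rect (fun=> B) idx
    (fun i y => op y (F x i)) (n x)).
  by apply: computable_natrec; computability.
apply: eq_computable => x; elim: (n x) => [|m IH] /=; first by rewrite big_geq.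
by rewrite big_nat_recr //= IH.
Qed.

Lemma computable_big_and X (EX : encoding X) (F : X -> nat -> bool) n :
  computable (fun p : X * nat => F p.1 p.2) -> computable n ->
  computable (fun x => \big[andb/true]_(0 <= i < n x) F x i).
Proof.
apply: computable_big.
by have H : computable (fun p : bool * bool => p.1 && p.2) by computability.
Qed.

#[global] Hint Extern 0
    (computable (fun x => \big[andb/true]_(0 <= i < _) _)) =>
  apply: computable_big_and; computability : computability.

Lemma computable_big_or X (EX : encoding X) (F : X -> nat -> bool) n :
  computable (fun p : X * nat => F p.1 p.2) -> computable n ->
  computable (fun x => \big[orb/false]_(0 <= i < n x) F x i).
Proof.
apply: computable_big.
by have H : computable (fun p : bool * bool => p.1 || p.2) by computability.
Qed.

#[global] Hint Extern 0
    (computable (fun x => \big[orb/false]_(0 <= i < _) _)) =>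
  apply: computable_big_or; computability : computability.

(** An unbounded search over A runs through the natural numbers by means of
    [dec], which may take a value repeatedly. *)
Definition enumerable A {EA : encoding A} :=
  exists2 dec : nat -> A, computable dec & forall a, exists n, dec n = a.

Arguments enumerable A {EA}.

Lemma enumerable_nat : enumerable nat.
Proof. by exists id; [apply: computable_id | move=> n; exists n]. Qed.

Lemma enumerable_pair A (EA : encoding A) B (EB : encoding B) :
  enumerable A -> enumerable B -> enumerable (A * B).
Proof.
move=> [f cf f_onto] [g cg g_onto].
exists (fun n => (f (code_head n), g (code_head (code_tail n)))) => [|[a b]].
  apply: computable_pair.
    by apply: (computable_comp cf); apply: computable_code_head; computability.
  apply: (computable_comp cg); apply: computable_code_head.
  by apply: computable_code_tail; computability.
have [[m <-] [n <-]] := (f_onto a, g_onto b).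
exists (CodeSeq.code [:: m; n]).
by rewrite code_tail_cons !code_head_cons.
Qed.

Lemma computable_decode : computable CodeSeq.decode.
Proof.
apply: (computable_recode (g := id)) (computable_id) => n.
by rewrite -[LHS]CodeSeq.decodeK /enc /enc_seq map_id.
Qed.

Lemma enumerable_seq A (EA : encoding A) : enumerable A -> enumerable (seq A).
Proof.
move=> [f cf f_onto].
have cd := computable_decode.
exists (fun n => mkseq (fun i => f (nth 0 (CodeSeq.decode n) i))
  (size (CodeSeq.decode n))) => [|s]; first by computability.
have [t <-] : exists t, map f t = s.
  elim: s => [|a s [t <-]]; first by exists [::].
  by have [n <-] := f_onto a; exists (n :: t).
exists (CodeSeq.code t); rewrite CodeSeq.codeK.
rewrite -[X in _ = map f X](mkseq_nth 0) -map_comp.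
by apply: eq_map => i.
Qed.

Lemma injective_enc_seq A (EA : encoding A) :
  injective (enc : A -> nat) -> injective (enc : seq A -> nat).
Proof. by move=> inj s t /(can_inj CodeSeq.codeK) /(inj_map inj). Qed.

Local Open Scope ring_scope.

(** * Computable arithmetic in rationals and number fields *)

#[global] Instance enc_rat : encoding rat := fun q => enc (rat_digits q).

Definition nat_frac (a b d : nat) : rat := (a%:R - b%:R) / d.+1%:R.

Definition nat_frac_digits a b d :=
  let m := ((a - b) + (b - a))%N in
  let e := (d.+1 %/ gcdn m d.+1)%N in
  [:: nat_of_bool (a < b)%N; (m * e %/ d.+1)%N; e].

(** Rationals are coded in lowest terms, so that arithmetic on codes has to
    reduce fractions: [m] is the absolute value of the numerator [a - b] and
    [e] is the denominator [d.+1] after reduction. *)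
Lemma rat_digits_nat_frac a b d :
  rat_digits (nat_frac a b d) = nat_frac_digits a b d.
Proof.
rewrite /nat_frac_digits; set m := (_ + _)%N; set g := gcdn m d.+1.
have g_gt0 : (0 < g)%N by rewrite gcdn_gt0 orbT.
have [dvd_m dvd_d] : (g %| m)%N /\ (g %| d.+1)%N.
  by rewrite dvdn_gcdl dvdn_gcdr.
pose s : int := (-1) ^+ (a < b)%N.
pose n : int := s * (m %/ g)%N%:Z; pose e : int := (d.+1 %/ g)%N%:Z.
have e_gt0 : 0 < e by rewrite ltz_nat divn_gt0 // dvdn_leq.
have cop : coprime `|n| `|e|.
  rewrite /n abszM absz_sign mul1n !absz_nat /coprime.
  by rewrite -(eqn_pmul2r g_gt0) mul1n muln_gcdl !divnK.
have fracE : nat_frac a b d = n%:Q / e%:Q.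
  have gQ : g%:R != 0 :> rat by rewrite pnatr_eq0 -lt0n.
  have -> : nat_frac a b d = s%:~R * m%:R / d.+1%:R.
    congr (_ / _); rewrite /s /m; case: ltnP => [lt_ab | le_ba].
      have -> : (a - b + (b - a) = b - a)%N by lia.
      by rewrite natrB 1?ltnW // rmorphN1 mulN1r opprB.
    have -> : (a - b + (b - a) = a - b)%N by lia.
    by rewrite natrB // mul1r.
  rewrite -{1}(divnK dvd_m) -{1}(divnK dvd_d) !natrM /n /e rmorphM /=.
  rewrite !pmulrn.
  have dQ : (d.+1 %/ g)%N%:R != 0 :> rat.
    by rewrite pnatr_eq0 -lt0n divn_gt0 // dvdn_leq.
  by rewrite pmulrn in dQ gQ; field; rewrite dQ gQ.
rewrite /rat_digits; congr [:: _; _; _].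
- congr nat_of_bool; rewrite /nat_frac ltr_pdivrMr ?ltr0n // mul0r subr_lt0.
  by rewrite ltr_nat.
- rewrite fracE coprimeq_num // gtr0_sg // mul1r /n abszM absz_sign mul1n.
  by rewrite absz_nat muln_divA // mulnC -muln_divA ?dvdn_mulr // ?mulKn.
by rewrite fracE coprimeq_den // gt_eqF // absz_nat.
Qed.

(** The reduced denominator is found by unbounded search, as the least positive
    [e] for which [d.+1] divides [m * e]. *)
Lemma computable_gcd_cofactor X (EX : encoding X) (f g : X -> nat) :
  computable f -> computable g ->
  computable (fun x => ((g x).+1 %/ gcdn (f x) (g x).+1)%N).
Proof.
move=> cf cg.
have test x e : (((f x * e) %% (g x).+1) == 0)%N =
    ((g x).+1 %/ gcdn (f x) (g x).+1 %| e)%N.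
  set h := gcdn _ _; have h_gt0 : (0 < h)%N by rewrite gcdn_gt0 orbT.
  have [hf hg] := (dvdn_gcdl (f x) (g x).+1, dvdn_gcdr (f x) (g x).+1).
  rewrite -[_ == _]/(_ %| _)%N -[X in (X %| f x * e)%N](divnK hg).
  rewrite -[X in (_ %| X * e)%N](divnK hf) -/h mulnAC dvdn_pmul2r //.
  rewrite Gauss_dvdr // coprime_sym /coprime -(eqn_pmul2r h_gt0) mul1n.
  by rewrite muln_gcdl !divnK ?dvdn_gcdl ?dvdn_gcdr.
apply: (computable_mu
  (F := fun x e => (0 < e)%N && (((f x * e) %% (g x).+1) == 0)%N)) => [|x|x e].
- by computability.
- rewrite test dvdnn andbT divn_gt0 ?gcdn_gt0 ?orbT //.
  by rewrite dvdn_leq ?dvdn_gcdr.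
rewrite test => lt_e; apply/negP=> /andP[e_gt0 /(dvdn_leq e_gt0)].
by rewrite leqNgt lt_e.
Qed.

Lemma computable_nat_frac X (EX : encoding X) (a b d : X -> nat) :
  computable a -> computable b -> computable d ->
  computable (fun x => nat_frac (a x) (b x) (d x)).
Proof.
move=> ca cb cd.
apply: (computable_recode (g := fun x => nat_frac_digits (a x) (b x) (d x))).
  by move=> x; rewrite -rat_digits_nat_frac.
have ce : computable (fun x =>
    ((d x).+1 %/ gcdn ((a x - b x) + (b x - a x)) (d x).+1)%N).
  by apply: computable_gcd_cofactor; computability.
rewrite /nat_frac_digits; apply: computable_cons; last by computability.
by apply: (computable_enc (f := fun x => (a x < b x)%N)); computability.
Qed.

Definition pos_part (q : rat) : nat :=
  if nth 0%N (rat_digits q) 0 == 0%N then nth 0%N (rat_digits q) 1 else 0%N.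
Definition neg_part (q : rat) : nat :=
  if nth 0%N (rat_digits q) 0 == 0%N then 0%N else nth 0%N (rat_digits q) 1.
Definition den_pred (q : rat) : nat := (nth 0%N (rat_digits q) 2).-1.

Lemma den_predE q : (den_pred q).+1%:R = (denq q)%:~R :> rat.
Proof.
by rewrite /den_pred /= prednK ?absz_gt0 ?denq_neq0 // pmulrn absz_denq.
Qed.

Lemma nat_fracK q : nat_frac (pos_part q) (neg_part q) (den_pred q) = q.
Proof.
rewrite /nat_frac den_predE -[RHS]divq_num_den; congr (_ / _).
rewrite /pos_part /neg_part /=; case: (ltrP q 0) => [q0 | q0] /=.
  rewrite sub0r pmulrn abszE ltr0_norm ?numq_lt0 //.
  by rewrite rmorphN opprK.
by rewrite subr0 pmulrn abszE ger0_norm // numq_ge0.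
Qed.

Lemma nat_fracD a b d a' b' d' : nat_frac a b d + nat_frac a' b' d' =
  nat_frac (a * d'.+1 + a' * d.+1) (b * d'.+1 + b' * d.+1) (d.+1 * d'.+1).-1.
Proof.
rewrite /nat_frac prednK ?muln_gt0 // !natrD !natrM; field.
by rewrite !nat1r !pnatr_eq0.
Qed.

Lemma nat_fracM a b d a' b' d' : nat_frac a b d * nat_frac a' b' d' =
  nat_frac (a * a' + b * b') (a * b' + b * a') (d.+1 * d'.+1).-1.
Proof.
rewrite /nat_frac prednK ?muln_gt0 // !natrD !natrM; field.
by rewrite !nat1r !pnatr_eq0.
Qed.

Lemma nat_fracN a b d : - nat_frac a b d = nat_frac b a d.
Proof. by rewrite /nat_frac -mulNr opprB. Qed.

Lemma computable_parts X (EX : encoding X) (f : X -> rat) : computable f ->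
  [/\ computable (fun x => pos_part (f x)),
      computable (fun x => neg_part (f x)) &
      computable (fun x => den_pred (f x))].
Proof.
move=> cf; have: computable (fun x => rat_digits (f x)).
  exact: (computable_recode (g := f)).
by split; rewrite /pos_part /neg_part /den_pred; computability.
Qed.

Lemma computable_addq X (EX : encoding X) (f g : X -> rat) :
  computable f -> computable g -> computable (fun x => f x + g x).
Proof.
move=> /computable_parts[f1 f2 f3] /computable_parts[g1 g2 g3].
pose a1 x := (pos_part (f x) * (den_pred (g x)).+1)%N.
pose a2 x := (pos_part (g x) * (den_pred (f x)).+1)%N.
pose b1 x := (neg_part (f x) * (den_pred (g x)).+1)%N.
pose b2 x := (neg_part (g x) * (den_pred (f x)).+1)%N.
have: computable (fun x => nat_frac (a1 x + a2 x) (b1 x + b2 x)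
    ((den_pred (f x)).+1 * (den_pred (g x)).+1).-1).
  by apply: computable_nat_frac; rewrite /a1 /a2 /b1 /b2; computability.
apply: eq_computable => x.
by rewrite -[in RHS](nat_fracK (f x)) -[in RHS](nat_fracK (g x)) nat_fracD.
Qed.

#[global] Hint Extern 0 (computable (fun x => GRing.add _ _)) =>
  apply: computable_addq; computability : computability.

Lemma computable_mulq X (EX : encoding X) (f g : X -> rat) :
  computable f -> computable g -> computable (fun x => f x * g x).
Proof.
move=> /computable_parts[f1 f2 f3] /computable_parts[g1 g2 g3].
have: computable (fun x => nat_frac
    (pos_part (f x) * pos_part (g x) + neg_part (f x) * neg_part (g x))
    (pos_part (f x) * neg_part (g x) + neg_part (f x) * pos_part (g x))
    ((den_pred (f x)).+1 * (den_pred (g x)).+1).-1).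
  by apply: computable_nat_frac; computability.
apply: eq_computable => x.
by rewrite -[in RHS](nat_fracK (f x)) -[in RHS](nat_fracK (g x)) nat_fracM.
Qed.

#[global] Hint Extern 0 (computable (fun x => GRing.mul _ _)) =>
  apply: computable_mulq; computability : computability.

Lemma computable_oppq X (EX : encoding X) (f : X -> rat) :
  computable f -> computable (fun x => - f x).
Proof.
move=> /computable_parts[f1 f2 f3].
have: computable (fun x =>
    nat_frac (neg_part (f x)) (pos_part (f x)) (den_pred (f x))).
  exact: computable_nat_frac.
by apply: eq_computable => x; rewrite -nat_fracN nat_fracK.
Qed.

#[global] Hint Extern 0 (computable (fun x => GRing.opp _)) =>
  apply: computable_oppq; computability : computability.

Lemma computable_sumq X (EX : encoding X) (F : X -> nat -> rat) n :
  computable (fun p : X * nat => F p.1 p.2) -> computable n ->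
  computable (fun x => \sum_(0 <= i < n x) F x i).
Proof.
apply: computable_big.
by have H : computable (fun p : rat * rat => p.1 + p.2) by computability.
Qed.

#[global] Hint Extern 0 (computable (fun x => \sum_(0 <= i < _) _)) =>
  apply: computable_sumq; computability : computability.

Lemma injective_enc_rat : injective (enc : rat -> nat).
Proof.
move=> p q /(can_inj CodeSeq.codeK); rewrite !map_id => pq.
by rewrite -(nat_fracK p) -(nat_fracK q) /pos_part /neg_part /den_pred pq.
Qed.

Lemma enumerable_rat : enumerable rat.
Proof.
have [f cf f_onto] : enumerable (nat * (nat * nat)).
  by do 2!apply: enumerable_pair enumerable_nat _; apply: enumerable_nat.
exists (fun n => nat_frac (f n).1 (f n).2.1 (f n).2.2) => [|q].
  by apply: computable_nat_frac; computability.
have [n fn] := f_onto (pos_part q, (neg_part q, den_pred q)).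
by exists n; rewrite fn nat_fracK.
Qed.

Section NumberField.

Variable K : fieldExtType rat.
Let N := \dim {:K}.
Let b := vbasis {:K}.

#[global] Instance enc_elt : encoding K := fun x => enc (elt_digits x).

Definition coords (x : K) : seq rat := [seq coord b i x | i <- enum 'I_N].
Definition of_coords (s : seq rat) : K := \sum_(i < N) s`_i *: b`_i.

Lemma enc_coords x : enc (coords x) = enc x.
Proof.
rewrite -[enc x]/(CodeSeq.code (map enc (elt_digits x))).
by rewrite -[LHS]/(CodeSeq.code (map enc (coords x))) -!map_comp.
Qed.

Lemma nth_coords x (i : 'I_N) : (coords x)`_i = coord b i x.
Proof. by rewrite (nth_map i) ?size_enum_ord // nth_ord_enum. Qed.

Lemma coordsE x : coords x = mkseq (fun i => (coords x)`_i) N.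
Proof. by rewrite -[LHS](mkseq_nth 0) size_map size_enum_ord. Qed.

Lemma coordsK : cancel coords of_coords.
Proof.
move=> x; rewrite [RHS](coord_vbasis (memvf x)); apply: eq_bigr => i _.
by rewrite nth_coords.
Qed.

Lemma injective_enc_elt : injective (enc : K -> nat).
Proof.
move=> x y; rewrite -!enc_coords => /(injective_enc_seq injective_enc_rat).
exact: (can_inj coordsK).
Qed.

Lemma computable_coords X (EX : encoding X) (f : X -> K) :
  computable f -> computable (fun x => coords (f x)).
Proof. by apply: computable_recode => x; rewrite enc_coords. Qed.

(** Field elements share their codes with their coordinate lists, hence a
    field-valued function is computable as soon as its coordinates are. *)
Lemma computable_of_coords X (EX : encoding X) (F : X -> nat -> rat)
    (f : X -> K) :
  (forall x (i : 'I_N), (coords (f x))`_i = F x i) ->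
  computable (fun p : X * nat => F p.1 p.2) -> computable f.
Proof.
move=> fF cF; apply: (computable_recode (g := fun x => mkseq (F x) N)).
  move=> x; rewrite -enc_coords coordsE; congr enc.
  apply: (@eq_from_nth _ 0); rewrite !size_mkseq // => i lt_i.
  by rewrite !nth_mkseq // -[i]/(nat_of_ord (Ordinal lt_i)) fF.
by computability.
Qed.

Lemma computable_addf X (EX : encoding X) (f g : X -> K) :
  computable f -> computable g -> computable (fun x => f x + g x).
Proof.
move=> /computable_coords cf /computable_coords cg.
apply: (computable_of_coords
  (F := fun x i => (coords (f x))`_i + (coords (g x))`_i)).
  by move=> x i; rewrite !nth_coords linearD.
by computability.
Qed.

Lemma computable_oppf X (EX : encoding X) (f : X -> K) :
  computable f -> computable (fun x => - f x).
Proof.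
move=> /computable_coords cf.
apply: (computable_of_coords (F := fun x i => - (coords (f x))`_i)).
  by move=> x i; rewrite !nth_coords linearN.
by computability.
Qed.

Lemma computable_mulf X (EX : encoding X) (f g : X -> K) :
  computable f -> computable g -> computable (fun x => f x * g x).
Proof.
move=> /computable_coords cf /computable_coords cg.
(* The structure constants of the multiplication are part of the program. *)
pose sc := mkseq (fun u => mkseq (fun v => coords (b`_u * b`_v)) N) N.
apply: (computable_of_coords (F := fun x i =>
  \sum_(0 <= u < N) \sum_(0 <= v < N) (coords (f x))`_u * (coords (g x))`_v *
     nth 0 (nth [::] (nth [::] sc u) v) i)).
  move=> x i; rewrite nth_coords.
  rewrite -{1}(coordsK (f x)) -{1}(coordsK (g x)) /of_coords big_distrlr /=.
  rewrite big_mkord linear_sum; apply: eq_bigr => u _.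
  rewrite big_mkord linear_sum; apply: eq_bigr => v _.
  rewrite -scalerAl -scalerAr scalerA linearZ /=; congr (_ * _).
  by rewrite /sc !nth_mkseq // nth_coords.
by computability.
Qed.

Lemma enumerable_elt : enumerable K.
Proof.
have [f cf f_onto] := enumerable_seq enumerable_rat.
exists (fun n => of_coords (f n)) => [|x]; last first.
  by have [n fn] := f_onto (coords x); exists n; rewrite fn coordsK.
apply: (computable_of_coords (F := fun n i => (f n)`_i)); last by computability.
by move=> n i; rewrite nth_coords coord_sum_free ?(basis_free (vbasisP _)).
Qed.

Lemma computable_eqf X (EX : encoding X) (f g : X -> K) :
  computable f -> computable g -> computable (fun x => f x == g x).
Proof. exact: computable_eq injective_enc_elt. Qed.

Lemma computable_eq_seqf X (EX : encoding X) (f g : X -> seq K) :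
  computable f -> computable g -> computable (fun x => f x == g x).
Proof. exact: computable_eq (injective_enc_seq injective_enc_elt). Qed.

End NumberField.

#[global] Hint Extern 0 (computable (fun x => GRing.add _ _)) =>
  apply: computable_addf; computability : computability.
#[global] Hint Extern 0 (computable (fun x => GRing.opp _)) =>
  apply: computable_oppf; computability : computability.
#[global] Hint Extern 0 (computable (fun x => GRing.mul _ _)) =>
  apply: computable_mulf; computability : computability.
#[global] Hint Extern 0 (computable (fun x => eq_op _ _)) =>
  apply: computable_eqf; computability : computability.
#[global] Hint Extern 0 (computable (fun x => eq_op _ _)) =>
  apply: computable_eq_seqf; computability : computability.

(** An inverse is found by searching through all field elements. *)
Lemma computable_invf X (EX : encoding X) (K : fieldExtType rat) (f : X -> K) :
  computable f -> computable (fun x => (f x)^-1).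
Proof.
move=> cf; have [dec cdec dec_onto] := enumerable_elt K.
pose F x n := (f x == 0) && (dec n == 0) || (f x * dec n == 1).
have exF x : exists n, F x n.
  have [n decn] := dec_onto (f x)^-1; exists n; rewrite /F decn invr_eq0 andbb.
  by case: eqVneq => //= nz; rewrite mulfV ?eqxx.
have cn : computable (fun x => ex_minn (exF x)).
  apply: (computable_mu (F := F)) => [|x|x i].
  - by rewrite /F; computability.
  - by case: ex_minnP.
  case: ex_minnP => m _ min_m lt_im; apply/negP=> /min_m.
  by rewrite leqNgt lt_im.
have: computable (fun x => dec (ex_minn (exF x))) by computability.
apply: eq_computable => x; case: ex_minnP => n Fn _.
case/orP: Fn => [/andP[/eqP-> /eqP->]|/eqP E]; first by rewrite invr0.
have nz : f x != 0.
  by apply: contra_eq_neq E => ->; rewrite mul0r eq_sym oner_neq0.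
by apply: (mulfI nz); rewrite E mulfV.
Qed.

#[global] Hint Extern 0 (computable (fun x => GRing.inv _)) =>
  apply: computable_invf; computability : computability.

Lemma computable_sumf X (EX : encoding X) (K : fieldExtType rat)
    (F : X -> nat -> K) n :
  computable (fun p : X * nat => F p.1 p.2) -> computable n ->
  computable (fun x => \sum_(0 <= i < n x) F x i).
Proof.
apply: computable_big.
by have H : computable (fun p : K * K => p.1 + p.2) by computability.
Qed.

#[global] Hint Extern 0 (computable (fun x => \sum_(0 <= i < _) _)) =>
  apply: computable_sumf; computability : computability.

Lemma computable_prodf X (EX : encoding X) (K : fieldExtType rat)
    (F : X -> nat -> K) n :
  computable (fun p : X * nat => F p.1 p.2) -> computable n ->
  computable (fun x => \prod_(0 <= i < n x) F x i).
Proof.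
apply: computable_big.
by have H : computable (fun p : K * K => p.1 * p.2) by computability.
Qed.

#[global] Hint Extern 0 (computable (fun x => \prod_(0 <= i < _) _)) =>
  apply: computable_prodf; computability : computability.

Lemma computable_natr X (EX : encoding X) (K : fieldExtType rat) (n : X -> nat) :
  computable n -> computable (fun x => (n x)%:R : K).
Proof.
move=> cn.
have: computable (fun x => \sum_(0 <= i < n x) (1 : K)) by computability.
by apply: eq_computable => x; rewrite big_const_nat subn0 iter_addr_0.
Qed.

#[global] Hint Extern 0 (computable (fun x => GRing.natmul (GRing.one _) _)) =>
  apply: computable_natr; computability : computability.

Lemma computable_sign X (EX : encoding X) (K : fieldExtType rat) (n : X -> nat) :
  computable n -> computable (fun x => (-1) ^+ n x : K).
Proof.
move=> cn.
have: computable (fun x => \prod_(0 <= i < n x) (-1 : K)) by computability.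
by apply: eq_computable => x; rewrite prodr_const_nat subn0.
Qed.

#[global] Hint Extern 0
    (computable (fun x => GRing.exp (GRing.opp (GRing.one _)) _)) =>
  apply: computable_sign; computability : computability.

(** * Computability of the certificate test *)

Lemma computable_bump X (EX : encoding X) (h i : X -> nat) :
  computable h -> computable i -> computable (fun x => bump (h x) (i x)).
Proof.
move=> ch ci.
have: computable (fun x => if (h x <= i x)%N then (i x).+1 else i x).
  by computability.
by apply: eq_computable => x; rewrite /bump; case: leqP.
Qed.

#[global] Hint Extern 0 (computable (fun x => bump _ _)) =>
  apply: computable_bump; computability : computability.

Lemma computable_digit X (EX : encoding X) (t a m : X -> nat) :
  computable t -> computable a -> computable m ->
  computable (fun x => digit (t x) (a x) (m x)).
Proof. by move=> *; rewrite /digit; computability. Qed.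

#[global] Hint Extern 0 (computable (fun x => digit _ _ _)) =>
  apply: computable_digit; computability : computability.

Lemma computable_vandermonde_product X (EX : encoding X) (K : fieldExtType rat)
    (q : X -> nat) (f : X -> nat -> nat) :
  computable q -> computable (fun p : X * nat => f p.1 p.2) ->
  computable (fun x => vandermonde_product K (q x) (f x)).
Proof. by move=> *; rewrite /vandermonde_product; computability. Qed.

Lemma computable_scaled_det X (EX : encoding X) (K : fieldExtType rat)
    (q : X -> nat) (A : X -> nat -> nat -> K) :
  computable q -> computable (fun p : X * (nat * nat) => A p.1 p.2.1 p.2.2) ->
  computable (fun x => scaled_det (q x) (A x)).
Proof.
move=> cq cA; rewrite /scaled_det; apply: computable_sumf; last by computability.
apply: computable_mulf.
  by apply: computable_vandermonde_product; computability.
apply: computable_prodf; last by computability.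
pose g (p : X * nat * nat) := (p.1.1, (p.2, digit (q p.1.1) p.2 p.1.2)).
by apply: (computable_comp cA (g := g)); rewrite /g; computability.
Qed.

#[global] Hint Extern 0 (computable (fun x => scaled_det _ _)) =>
  apply: computable_scaled_det; computability : computability.

Lemma computable_window X (EX : encoding X) (K : fieldExtType rat)
    (c : X -> nat -> K) (j k e i b n : X -> nat) :
  computable (fun p : X * nat => c p.1 p.2) ->
  computable j -> computable k -> computable e -> computable i ->
  computable b -> computable n ->
  computable (fun x => window (c x) (j x) (k x) (e x) (i x) (b x) (n x)).
Proof. by move=> *; rewrite /window /lag_index; computability. Qed.

#[global] Hint Extern 0
    (computable (fun x => window _ _ _ _ _ _ _)) =>
  apply: computable_window; computability : computability.

Lemma computable_coefficient X (EX : encoding X) (K : fieldExtType rat)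
    (c : X -> nat -> K) (t j k e q m i n : X -> nat) :
  computable (fun p : X * nat => c p.1 p.2) ->
  computable t -> computable j -> computable k -> computable e ->
  computable q -> computable m -> computable i -> computable n ->
  computable (fun x => coefficient (c x) (t x) (j x) (k x)
    (e x) (q x) (m x) (i x) (n x)).
Proof. by move=> *; rewrite /coefficient; computability. Qed.

#[global] Hint Extern 0
    (computable (fun x => coefficient _ _ _ _ _ _ _ _ _)) =>
  apply: computable_coefficient; computability : computability.

Lemma computable_relation X (EX : encoding X) (K : fieldExtType rat)
    (c : X -> nat -> K) (t j k e q m b n : X -> nat) :
  computable (fun p : X * nat => c p.1 p.2) ->
  computable t -> computable j -> computable k -> computable e ->
  computable q -> computable m -> computable b -> computable n ->
  computable (fun x => relation (c x) (t x) (j x) (k x)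
    (e x) (q x) (m x) (b x) (n x)).
Proof. by move=> *; rewrite /relation; computability. Qed.

#[global] Hint Extern 0
    (computable (fun x => relation _ _ _ _ _ _ _ _ _)) =>
  apply: computable_relation; computability : computability.

Lemma computable_lag_test X (EX : encoding X) (K : fieldExtType rat)
    (c : X -> nat -> K) (t j k M e q m : X -> nat) :
  computable (fun p : X * nat => c p.1 p.2) ->
  computable t -> computable j -> computable k -> computable M ->
  computable e -> computable q -> computable m ->
  computable (fun x => lag_test (c x) (t x) (j x) (k x)
    (M x) (e x) (q x) (m x)).
Proof. by move=> *; rewrite /lag_test /order_bound; computability. Qed.

#[global] Hint Extern 0
    (computable (fun x => lag_test _ _ _ _ _ _ _ _)) =>
  apply: computable_lag_test; computability : computability.

Lemma computable_good_lag X (EX : encoding X) (K : fieldExtType rat)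
    (c : X -> nat -> K) (t j k M e : X -> nat) :
  computable (fun p : X * nat => c p.1 p.2) ->
  computable t -> computable j -> computable k -> computable M ->
  computable e ->
  computable (fun x => good_lag (c x) (t x) (j x) (k x) (M x) (e x)).
Proof. by move=> *; rewrite /good_lag; computability. Qed.

#[global] Hint Extern 0
    (computable (fun x => good_lag _ _ _ _ _ _)) =>
  apply: computable_good_lag; computability : computability.

Lemma computable_stretched X (EX : encoding X) (K : fieldExtType rat)
    (c : X -> nat -> K) (t j k e q m i n : X -> nat) :
  computable (fun p : X * nat => c p.1 p.2) ->
  computable t -> computable j -> computable k -> computable e ->
  computable q -> computable m -> computable i -> computable n ->
  computable (fun x => stretched (c x) (t x) (j x) (k x)
    (e x) (q x) (m x) (i x) (n x)).
Proof. by move=> *; rewrite /stretched; computability. Qed.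

#[global] Hint Extern 0
    (computable (fun x => stretched _ _ _ _ _ _ _ _ _)) =>
  apply: computable_stretched; computability : computability.

Lemma computable_presentation_test X (EX : encoding X) (K : fieldExtType rat)
    (c : X -> nat -> K) (t j k e q m i : X -> nat)
    (D : X -> seq K * seq K) :
  computable (fun p : X * nat => c p.1 p.2) ->
  computable t -> computable j -> computable k -> computable e ->
  computable q -> computable m -> computable i -> computable D ->
  computable (fun x => presentation_test (c x) (t x) (j x) (k x)
    (e x) (q x) (m x) (i x) (D x)).
Proof. by move=> *; rewrite /presentation_test; computability. Qed.

#[global] Hint Extern 0
    (computable (fun x => presentation_test _ _ _ _ _ _ _ _ _)) =>
  apply: computable_presentation_test; computability : computability.

Lemma computable_certificate_test X (EX : encoding X) (K : fieldExtType rat)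
    (c : X -> nat -> K) (t j k M e q m : X -> nat)
    (E : X -> seq (seq K * seq K)) :
  computable (fun p : X * nat => c p.1 p.2) ->
  computable t -> computable j -> computable k -> computable M ->
  computable e -> computable q -> computable m -> computable E ->
  computable (fun x => certificate_test (c x) (t x) (j x) (k x)
    (M x) (e x) (q x) (m x) (E x)).
Proof. by move=> *; rewrite /certificate_test; computability. Qed.

(** * The algorithm and its correctness *)

Section Presentations.

Variable K : fieldExtType rat.
Implicit Types (D : seq K * seq K) (c : nat -> K).

(** One step of the recurrence, on a list of consecutive terms. *)
Definition next_window D (s : seq K) : seq K :=
  mkseq (fun i => if (i.+1 < size D.2)%N then s`_i.+1 else
    - ((D.1`_(size D.2))^-1 * \sum_(0 <= l < size D.2) D.1`_l * s`_l)) (size D.2).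

Definition presented D n : K :=
  (nat_rect (fun=> seq K) D.2 (fun _ => next_window D) n)`_0.

Lemma presentedE D c : presents D c -> presented D =1 c.
Proof.
case=> szD [nz rec] initD n.
have winE : forall i, (i < size D.2)%N ->
    (nat_rect (fun=> seq K) D.2 (fun _ => next_window D) n)`_i = c (n + i)%N.
  elim: n => [|n IH] i lt_i /=; first by rewrite {1}initD nth_mkseq.
  rewrite nth_mkseq //; case: ltnP => [lt_i1|le_i]; first by rewrite IH // addSnnS.
  have -> : (n.+1 + i = n + size D.2)%N by lia.
  apply: (mulfI nz); rewrite mulrN mulrA mulfV // mul1r.
  have /eqP := rec n; rewrite big_ord_recr /= addrC addr_eq0 => /eqP ->.
  by congr (- _); rewrite big_mkord; apply: eq_bigr => l _; rewrite IH.
rewrite /presented; have [t0|t_gt0] := posnP (size D.2); last by rewrite winE // addn0.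
have -> : c n = 0.
  have /eqP := rec n; rewrite t0 in nz *.
  by rewrite big_ord1 addn0 mulf_eq0 (negPf nz) => /eqP.
case: n {winE} => [|n] /=; first by rewrite (size0nil t0).
by rewrite /next_window t0.
Qed.

Lemma C_finite_presented c : C_finite c -> exists D, presents D c.
Proof.
move=> [t [gamma [nz rec]]].
have [s1 sz1 s1E] : exists2 s1, size s1 = t.+1 &
    forall l, (l < t.+1)%N -> s1`_l = gamma l.
  by exists (mkseq gamma t.+1) => [|l lt_l]; rewrite ?size_mkseq ?nth_mkseq.
exists (s1, mkseq c t); split; rewrite /= size_mkseq //; split=> [|n].
  by rewrite s1E.
by rewrite -[RHS](rec n); apply: eq_bigr => i _; rewrite s1E.
Qed.

(** The bound of [torsion_order_dvd_fact], computed from the data alone. *)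
Definition torsion_modulus D : nat :=
  (2 * (\dim {:K} * size D.2 ^ size D.2))`!.

Lemma computable_next_window : computable (fun p : (seq K * seq K) * seq K =>
  next_window p.1 p.2).
Proof. by rewrite /next_window; computability. Qed.

Lemma computable_presented :
  computable (fun p : (seq K * seq K) * nat => presented p.1 p.2).
Proof.
rewrite /presented; apply: computable_nth; last by computability.
have cw := computable_next_window.
by apply: computable_natrec; computability.
Qed.

Lemma computable_torsion_modulus : computable torsion_modulus.
Proof. by rewrite /torsion_modulus; computability. Qed.

Lemma enc_map_elt (s : seq K) : enc s = pickle (map (@elt_digits K) s).
Proof.
rewrite -[LHS]/(CodeSeq.code (map enc s)).
by rewrite -[RHS]/(CodeSeq.code (map pickle (map (@elt_digits K) s))) -map_comp.
Qed.

Lemma enc_data D : enc D = code_data D.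
Proof.
by rewrite -[LHS]/(CodeSeq.code [:: enc D.1; enc D.2]) !enc_map_elt.
Qed.

Lemma enc_data_list (E : seq (seq K * seq K)) : enc E = code_data_list E.
Proof.
rewrite -[LHS]/(CodeSeq.code (map enc E)).
rewrite -[RHS]/(CodeSeq.code (map pickle (map (@data_digits K) E))) -map_comp.
by congr CodeSeq.code; apply: eq_map => D; apply: enc_data.
Qed.

End Presentations.

Section Correctness.

Variables (K : fieldExtType rat) (iota : {rmorphism K -> algC}).
Variables (c : nat -> K) (r : nat) (chi : {poly K}) (lam : seq algC) (d : nat).
Hypothesis order_c : C_finite_of_order c r.
Hypothesis char_c : characteristic_poly c chi.
Hypothesis uniq_lam : uniq lam.
Hypothesis lamP : forall z : algC, (z \in lam) = root (map_poly iota chi) z.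
Hypothesis lam0 : forall z : algC, z \in lam -> z != 0.
Hypothesis tors_d : is_torsion_number lam d.

Variable D : seq K * seq K.
Hypothesis presents_D : presents D c.
Variables j k : nat.

Let t := size D.2.
Let M := torsion_modulus D.

Lemma presented_recurrence : C_recurrence t (nth 0 D.1) c.
Proof. by case: presents_D. Qed.

Lemma torsion_modulus_gt0 : (0 < M)%N.
Proof. exact: fact_gt0. Qed.

Lemma torsion_modulus_kills : kills_torsion lam M.
Proof.
move=> z n [Gz _] prim_z.
have le_chi : ((size chi).-1 <= t)%N.
  by case: char_c => [[_ min_chi] _ _]; apply: min_chi presented_recurrence.
have le_lam := leq_trans (size_lam char_c lamP uniq_lam) le_chi.
have lam_root y : y \in lam -> root (map_poly iota chi) y by rewrite lamP.
exact: (torsion_order_dvd_fact (chi_monic char_c) lam_root (chi_coef0 lamP lam0)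
  Gz prim_z le_chi le_lam).
Qed.

Lemma torsion_number_gt0 : (0 < d)%N.
Proof.
have [_ min_d] := tors_d.
have dM : (d %| M)%N by apply: min_d; apply: torsion_modulus_kills.
exact: dvdn_gt0 torsion_modulus_gt0 dM.
Qed.

(** For the step d the leading minor has bases in a torsion-free group, and
    cannot vanish on a residue class without being zero. *)
Lemma torsion_number_good : good_lag c t j k M d.
Proof.
have [q [m [lt_m nz rel0]]] := exists_maximal_minor j k d presented_recurrence.
have [n nz_n] := nz.
apply/big_orP; exists q.
  by rewrite ltnS (leading_order_le presented_recurrence nz_n).
apply/big_orP; exists m => //.
apply/(lag_testP _ _ presented_recurrence); split=> // rho _.
apply: NNPP => no_n; case/eqP: nz_n.
rewrite -[n]addn0 -[n]mul1n.
apply: (nondegenerate_subsequence char_c lamP lam0 (D := d) (p := M) (r0 := rho)).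
- by case: tors_d.
- exact: torsion_number_gt0.
- by rewrite muln1.
- exact: torsion_modulus_gt0.
move=> n'; apply: NNPP => /eqP nz'; apply: no_n; exists n'.
by rewrite mul1n addn0 in nz'.
Qed.

(** The step is at most d because d passes the test, and q is at most r because
    a non-zero minor has at most r rows. *)
Lemma certificate_sound l e q m E : certificate_test c t j k M e q m E ->
  let a := fun n : nat => c (j * n ^ 2 + k * n + l)%N in
  [/\ (e * q <= d * r)%N,
      C2_finite_recurrence (e * q) (stretched c t j k e q m) a,
      size E = (e * q).+1 &
      forall i : nat, (i <= e * q)%N ->
        presents (nth ([::], [::]) E i) (stretched c t j k e q m i)].
Proof.
case/and5P=> e_gt0 /(lag_testP _ _ presented_recurrence)[rel0 nz] /big_andP min_e.
move=> /eqP sizeE /big_andP presE a.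
have presE' i : (i <= e * q)%N ->
    presents (nth ([::], [::]) E i) (stretched c t j k e q m i).
  by move=> le_i; apply: (presentation_test_sound presented_recurrence); apply: presE.
split=> //.
  have [[gam rec_r] _] := order_c.
  have [n nz_n] := nz 0 torsion_modulus_gt0.
  apply: leq_mul; last exact: leading_order_le rec_r nz_n.
  rewrite leqNgt; apply/negP=> lt_de; have := min_e d lt_de.
  by rewrite torsion_number_good orbF eqn0Ngt torsion_number_gt0.
split.
- move=> i /presE'[_ rec_i _]; set D_i := nth _ E i in rec_i.
  by exists (size D_i.2), (nth 0 D_i.1).
- have [n1 nz1] := eventually_nonzero char_c lamP lam0
    torsion_modulus_kills torsion_modulus_gt0 nz.
  by exists n1 => n /nz1; rewrite /stretched modnMr eqxx mulKn.
by move=> n; apply: (stretched_recurrence presented_recurrence).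
Qed.

End Correctness.

Theorem theorem19 (K : fieldExtType rat) :
  exists P : recfun,
  forall (c : nat -> K) (r : nat) (chi : {poly K})
         (iota : {rmorphism K -> algC}) (lam : seq algC) (d : nat),
    C_finite_of_order c r ->
    characteristic_poly c chi ->
    uniq lam ->
    (forall z : algC, (z \in lam) = root (map_poly iota chi) z) ->
    (forall z : algC, z \in lam -> z != 0) ->
    is_torsion_number lam d ->
    forall j k l : nat,
      let a := fun n : nat => c (j * n ^ 2 + k * n + l)%N in
      (exists (s : nat) (cs : nat -> nat -> K),
         (s <= d * r)%N /\ C2_finite_recurrence s cs a) /\
      (forall D : seq K * seq K, presents D c ->
         exists (s : nat) (cs : nat -> nat -> K) (E : seq (seq K * seq K)),
           [/\ (s <= d * r)%N,
               C2_finite_recurrence s cs a,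
               size E = s.+1,
               (forall i : nat, (i <= s)%N ->
                  presents (nth ([::], [::]) E i) (cs i)) &
               recfun_eval P [:: code_data D; j; k; l] (code_data_list E)]).
Proof.
have [dec cdec dec_onto] : enumerable (nat * (nat * (nat * seq (seq K * seq K)))).
  do 3![apply: enumerable_pair enumerable_nat _].
  by apply/enumerable_seq/enumerable_pair; apply/enumerable_seq/enumerable_elt.
pose F (x : (seq K * seq K) * (nat * nat)) z :=
  certificate_test (presented x.1) (size x.1.2) x.2.1 x.2.2 (torsion_modulus x.1)
    (dec z).1 (dec z).2.1 (dec z).2.2.1 (dec z).2.2.2.
have [Pmu evalPmu] : exists P, forall x n, F x n ->
    (forall i, (i < n)%N -> ~~ F x i) -> recfun_eval P [:: enc x] n.
  apply: computable_partial_mu; rewrite /F.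
  have cM := @computable_torsion_modulus K.
  have cP := @computable_presented K.
  by apply: computable_certificate_test; computability.
have [Pout evalPout] : computable (fun z => (dec z).2.2.2) by computability.
have pr i : (i < 4)%N -> recursive 4 (fun v => nth 0%N v i) by apply: recursive_proj.
have [Ppack evalPpack] := recursive_comp2 recursive_code_cons (pr 0 isT)
  (recursive_comp2 recursive_code_cons
    (recursive_comp2 recursive_code_cons (pr 1 isT)
      (recursive_comp2 recursive_code_cons (pr 2 isT) (recursive0 4)))
    (recursive0 4)).
exists (Comp Pout [:: Comp Pmu [:: Ppack]]).
move=> c r chi iota lam d order_c char_c uniq_lam lamP lam0 tors_d j k l a.
have main D : presents D c ->
    exists (s : nat) (cs : nat -> nat -> K) (E : seq (seq K * seq K)),
      [/\ (s <= d * r)%N, C2_finite_recurrence s cs a, size E = s.+1,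
          (forall i : nat, (i <= s)%N -> presents (nth ([::], [::]) E i) (cs i)) &
          recfun_eval (Comp Pout [:: Comp Pmu [:: Ppack]])
            [:: code_data D; j; k; l] (code_data_list E)].
  move=> presD; have cE : presented D = c.
    by apply: functional_extensionality; apply: presentedE.
  have exz : exists z, F (D, (j, k)) z.
    have [||e [q [m [E testE]]]] := @certificate_exists K c (size D.2) j k
        (nth 0 D.1) _ (torsion_modulus D).
    - exact: presented_recurrence presD.
    - exists d.
        exact: (torsion_number_gt0 char_c uniq_lam lamP lam0 tors_d presD).
      exact: (torsion_number_good char_c uniq_lam lamP lam0 tors_d presD).
    have [z decz] := dec_onto (e, (q, (m, E))).
    by exists z; rewrite /F decz /= cE.
  have [z Fz min_z] := ex_minnP exz.
  pose w := dec z.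
  have testw : certificate_test c (size D.2) j k (torsion_modulus D)
      w.1 w.2.1 w.2.2.1 w.2.2.2.
    by move: Fz; rewrite /F /= cE.
  have [les rec_a sizeE presE] := certificate_sound order_c char_c uniq_lam
    lamP lam0 tors_d presD l testw.
  exists (w.1 * w.2.1)%N, (stretched c (size D.2) j k w.1 w.2.1 w.2.2.1), w.2.2.2.
  split=> //.
  apply: (eval_comp (ys := [:: z])); last by rewrite -enc_data_list; apply: evalPout.
  apply: evals_cons; last exact: evals_nil.
  apply: (eval_comp (ys := [:: enc (D, (j, k))])).
    apply: evals_cons; last exact: evals_nil.
    by have := evalPpack [:: code_data D; j; k; l] erefl; rewrite -enc_data.
  apply: evalPmu => // i lt_iz; apply/negP=> /min_z.
  by rewrite leqNgt lt_iz.
split=> //.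
have [D presD] : exists D, presents D c.
  by apply: C_finite_presented; case: order_c => [[gam rec_r] _]; exists r, gam.
by have [s [cs [E [? ? _ _ _]]]] := main D presD; exists s, cs.
Qed.
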